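(* Let $h\colon(\mathbb X,x_\bullet)\to(\mathbb Y,y_\bullet)$ be a flow equivalence with $h(x_\bullet)=y_\bullet$, and let $(X_i,f_i,p_i)$ and $(Y_i,g_i,q_i)$ be arbitrary expansions of $\mathbb X$ about $x_\bullet$ and of $\mathbb Y$ about $y_\bullet$. Then $h$ is isotopic to a combinatorial isomorphism relative to these expansions; in particular, the inverse sequences $(X_i,f_i)$ and $(Y_i,g_i)$ are isomorphic as inverse sequences of oriented wedges of circles with positive maps.
   Context: A flow space is a compact metrizable space of topological dimension one with a continuous $\mathbb R$-action without fixed points; a flow equivalence is a homeomorphism between flow spaces mapping orbits onto orbits preserving the flow orientation. Positive map: continuous surjection between oriented wedges of circles sending wedge point to wedge point, orientation preserving on each circle, locally injective away from the wedge point. Projection $\mathbb X\to W$: continuous surjection, locally injective and orientation preserving along orbits. Expansion of $\mathbb X$ about $x_\bullet$: oriented wedges $X_i$ with wedge points $x_i$, positive $f_i\colon X_{i+1}\to X_i$, projections $p_i$ with $p_i(x_\bullet)=x_i$, $p_n=f_{n,m}\circ p_m$ where $f_{n,m}=f_n\circ\cdots\circ f_{m-1}$, and $x\mapsto(p_i(x))_i$ a homeomorphism onto $\varprojlim(X_i,f_i)$. A combinatorial isomorphism relative to the expansions is a flow equivalence $d\colon\mathbb X\to\mathbb Y$ with $d(x_\bullet)=y_\bullet$ for which there are increasing sequences $m_1<m_2<\cdots$, $n_1<n_2<\cdots$ and positive maps $d_k\colon X_{m_k}\to Y_{n_k}$, $u_k\colon Y_{n_{k+1}}\to X_{m_k}$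 (wedge point to wedge point) with $u_k\circ d_{k+1}=f_{m_k,m_{k+1}}$, $d_k\circ u_k=g_{n_k,n_{k+1}}$ and $q_{n_k}\circ d=d_k\circ p_{m_k}$ for all $k$. Two inverse sequences are isomorphic if such a diagram of positive maps $d_k,u_k$ (satisfying the two triangle identities) exists. *)

(* Defs.v *)
From HB Require Import structures.
From mathcomp Require Import all_boot all_order all_algebra.
From mathcomp Require Import all_classical all_reals all_analysis.
Set Implicit Arguments. Unset Strict Implicit. Unset Printing Implicit Defensive.
Import Order.TTheory GRing.Theory Num.Theory.
Import numFieldNormedType.Exports.
Local Open Scope classical_set_scope.
Local Open Scope ring_scope.

Section FlowDefs.
Variable R : realType.

(* ---------- Oriented wedges of circles ----------
   A point of a wedge of circles is either the wedge point [None] or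
   [Some (k, t)]: the point at parameter t in (0,1) on circle number k.
   Circle k is parametrised by t in R/Z (t = 0 is the wedge point) and
   oriented by increasing t.  The wedge of n circles is the set of points
   satisfying [inw n]. *)
Definition wpoint := option (nat * {t : R | (0 < t < 1)%R}).

Definition inw (n : nat) (x : wpoint) : bool :=
  if x is Some (k, _) then (k < n)%N else true.

Definition wpt (k : nat) (t : R) : wpoint :=
  omap (fun u => (k, u))
    (insub (t - (Num.floor t)%:~R) : option {t : R | (0 < t < 1)%R}).

(* path metric of the wedge (each circle of length 1) *)
Definition edist (t : R) : R := Num.min t (1 - t).
Definition wdist (x y : wpoint) : R :=
  match x, y with
  | None, None => 0
  | None, Some (_, t) => edist (val t)
  | Some (_, t), None => edist (val t)
  | Some (k, s), Some (l, t) =>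
      if k == l then Num.min `|val s - val t| (1 - `|val s - val t|)
      else edist (val s) + edist (val t)
  end.

Definition wcont (m : nat) (f : wpoint -> wpoint) : Prop :=
  forall x, inw m x -> forall e : R, 0 < e ->
    exists2 d : R, 0 < d &
      forall y, inw m y -> wdist x y < d -> wdist (f x) (f y) < e.

(* [g] is locally injective and orientation preserving at time s0:
   near s0 it is injective, and on both sides of s0 it is of the form
   s |-> (point of a circle k at parameter a s) with a strictly increasing. *)
Definition pos_at (g : R -> wpoint) (s0 : R) : Prop :=
  exists2 d : R, 0 < d &
   [/\ (forall s s', `|s - s0| < d -> `|s' - s0| < d -> g s = g s' -> s = s'),
       (exists k (a : R -> R),
          (forall s, s0 - d < s -> s <= s0 -> g s = wpt k (a s)) /\
          (forall s s', s0 - d < s -> s < s' -> s' <= s0 -> a s < a s')) &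
       (exists k (a : R -> R),
          (forall s, s0 <= s -> s < s0 + d -> g s = wpt k (a s)) /\
          (forall s s', s0 <= s -> s < s' -> s' < s0 + d -> a s < a s'))].

Definition positive_map (m n : nat) (f : wpoint -> wpoint) : Prop :=
  [/\ forall x, inw m x -> inw n (f x),
      f None = None,
      wcont m f,
      (forall y, inw n y -> exists2 x, inw m x & f x = y) &
      forall k, (k < m)%N -> forall s0 : R, 0 < s0 < 1 ->
        pos_at (fun s => f (wpt k s)) s0].

Definition fcomp (f : nat -> wpoint -> wpoint) (i j : nat) : wpoint -> wpoint :=
  foldr (fun k acc => f k \o acc) id (iota i (j - i)).

Definition metrizable (X : topologicalType) : Prop :=
  exists d : X -> X -> R,
    [/\ forall x y, 0 <= d x y,
        forall x y, d x y = 0 <-> x = y,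
        forall x y, d x y = d y x,
        forall x y z, d x z <= d x y + d y z &
        forall A : set X, open A <->
          (forall x, A x -> exists2 e : R, 0 < e & forall y, d x y < e -> A y)].

Definition covdim_le (X : topologicalType) (n : nat) : Prop :=
  forall (k : nat) (U : 'I_k -> set X), (forall i, open (U i)) ->
    (forall x, exists i, U i x) ->
    exists (l : nat) (V : 'I_l -> set X),
      [/\ forall j, open (V j),
          forall x, exists j, V j x,
          forall j, exists i, V j `<=` U i &
          forall x, (#|[set j : 'I_l | `[< V j x >]]| <= n.+1)%N].

Definition topdim_one (X : topologicalType) : Prop :=
  covdim_le X 1 /\ ~ covdim_le X 0.

Definition is_flow (X : topologicalType) (phi : R -> X -> X) : Prop :=
  [/\ continuous (fun z : R * X => phi z.1 z.2),
      forall x, phi 0 x = x &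
      forall s t x, phi (s + t) x = phi s (phi t x)].

Definition flow_space (X : topologicalType) (phi : R -> X -> X) : Prop :=
  [/\ is_flow phi, compact [set: X], metrizable X, topdim_one X &
      forall x, exists t, phi t x <> x].

Definition homeo (X Y : topologicalType) (h : X -> Y) : Prop :=
  continuous h /\
  exists g : Y -> X, [/\ cancel h g, cancel g h & continuous g].

Definition flow_equiv (X Y : topologicalType) (phi : R -> X -> X)
    (psi : R -> Y -> Y) (h : X -> Y) : Prop :=
  homeo h /\
  forall x,
    h @` range (fun t => phi t x) = range (fun t => psi t (h x)) /\
    exists tau : R -> R, (forall s t, s < t -> tau s < tau t) /\
      forall t, h (phi t x) = psi (tau t) (h x).

Definition projection (X : topologicalType) (phi : R -> X -> X) (n : nat)
    (p : X -> wpoint) : Prop :=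
  [/\ forall x, inw n (p x),
      (forall x (e : R), 0 < e -> nbhs x [set y | wdist (p x) (p y) < e]),
      (forall y, inw n y -> exists x, p x = y) &
      forall x, pos_at (fun s => p (phi s x)) 0].

Definition expansion (X : topologicalType) (phi : R -> X -> X) (x0 : X)
    (n : nat -> nat) (f : nat -> wpoint -> wpoint) (p : nat -> X -> wpoint)
    : Prop :=
  [/\ forall i, positive_map (n i.+1) (n i) (f i),
      forall i, projection phi (n i) (p i),
      forall i, p i x0 = None,
      forall i j x, (i <= j)%N -> p i x = fcomp f i j (p j x) &
      (* x |-> (p_i x)_i is a homeomorphism onto the inverse limit *)
      [/\ forall x y, (forall i, p i x = p i y) -> x = y,
          (forall z : nat -> wpoint, (forall i, inw (n i) (z i)) ->
            (forall i, z i = f i (z i.+1)) -> exists x, (forall i, p i x = z i)) &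
          forall x (U : set X), open U -> U x ->
            exists (F : seq nat) (e : R), 0 < e /\
              forall y, (forall i, i \in F -> wdist (p i x) (p i y) < e) -> U y]].

Definition isotopic (X Y : topologicalType) (h d : X -> Y) : Prop :=
  exists H : R -> X -> Y,
    [/\ {within [set z : R * X | 0 <= z.1 <= 1], continuous (fun z => H z.1 z.2)},
        forall t, 0 <= t <= 1 -> homeo (H t),
        H 0 = h & H 1 = d].

Definition comb_iso (X Y : topologicalType) (phi : R -> X -> X)
    (psi : R -> Y -> Y) (x0 : X) (y0 : Y)
    (nX : nat -> nat) (f : nat -> wpoint -> wpoint) (p : nat -> X -> wpoint)
    (nY : nat -> nat) (g : nat -> wpoint -> wpoint) (q : nat -> Y -> wpoint)
    (d : X -> Y) : Prop :=
  [/\ flow_equiv phi psi d, d x0 = y0 &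
   exists (m nn : nat -> nat) (dk uk : nat -> wpoint -> wpoint),
   [/\ (forall k, (m k < m k.+1)%N) /\ (forall k, (nn k < nn k.+1)%N),
       (forall k, positive_map (nX (m k)) (nY (nn k)) (dk k)) /\
         (forall k, positive_map (nY (nn k.+1)) (nX (m k)) (uk k)),
       forall k z, inw (nX (m k.+1)) z -> uk k (dk k.+1 z) = fcomp f (m k) (m k.+1) z,
       forall k z, inw (nY (nn k.+1)) z -> dk k (uk k z) = fcomp g (nn k) (nn k.+1) z &
       forall k x, q (nn k) (d x) = dk k (p (m k) x)]].

End FlowDefs.

(* Main.v *)
Require Import Defs.
From HB Require Import structures.
From mathcomp Require Import all_boot all_order all_algebra.
From mathcomp Require Import all_classical all_reals all_analysis.
From mathcomp Require Import ring lra.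
Set Implicit Arguments. Unset Strict Implicit. Unset Printing Implicit Defensive.
Import Order.TTheory GRing.Theory Num.Theory.
Import numFieldNormedType.Exports.
Local Open Scope classical_set_scope.
Local Open Scope ring_scope.

(** Replacing each [q i] by [q i \o h] we may assume that both expansions live on the same
    flow space X and that h is the identity.

    A projection [p] is controlled by its angle in R/Z, which lifts along orbits to a
    continuous strictly increasing cocycle D; and near any point [a] the values of [p] are
    those taken on a short piece of the orbit of [a], so [p] is locally determined by its
    angle.  By compactness the fibres of [p i] shrink, so a projection which is locally
    determined by some [p m] factors through [p i] for all large i, and the factor is a
    positive map.

    Exactness: if [d \o p m = q l], then [p m] is locally determined by [q l] because [q l]
    is injective on short orbit pieces; hence [p m = u \o q l'] for some l' > l.  Thus one
    exact relation [d \o p m = q l] generates the whole ladder, with no further deformation.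

    To get that first relation, move every point along its orbit so that the angle of
    [q 0] becomes [N z * t] at the point where [p m] has angle t; here z is the last visit of
    the orbit to the wedge point of [p m] and the integer [N z] >= 1 counts the turns of [q 0]
    before the next visit.  For m large the visits happen close to the base point, which
    makes [N] well defined, locally constant and positive.  The displacement along orbits is
    a continuous function r, and x |-> phi (t * r x) x is the isotopy. *)

(** * Angles and the metric of a wedge *)

Section Wedge.
Variable R : realType.
Implicit Types (w : wpoint R) (u v : R).

(** The representative of [u] modulo 1 in [-1/2, 1/2); its absolute value is the distance from [u]
    to the nearest integer. *)
Definition cen u : R := u - (Num.floor (u + 2^-1))%:~R.

(** The value 0 is free for the wedge point because parameters on circles lie in (0,1); hence angle
    and circle together determine a point. *)
Definition ang w : R := if w is Some (_, t) then val t else 0.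

Definition circ w : option nat := omap fst w.

Lemma intr_small (x : R) : x \is a Num.int -> `|x| < 1 -> x = 0.
Proof.
move=> xi x1; apply/eqP; apply: contraLR x1 => x0; rewrite -leNgt.
by rewrite norm_intr_ge1.
Qed.

Lemma int_eq (x y : R) : x \is a Num.int -> x = y -> y \is a Num.int.
Proof. by move=> xi <-. Qed.

Lemma cen_mod u : u - cen u \is a Num.int.
Proof. by rewrite /cen opprB addrC subrK intr_int. Qed.

Lemma cen_ge u : - 2^-1 <= cen u.
Proof. rewrite /cen; have := Num.Theory.floor_le (u + 2^-1); lra. Qed.

Lemma cen_lt u : cen u < 2^-1.
Proof. rewrite /cen; have := floorD1_gt (u + 2^-1); rewrite intrD; lra. Qed.

Lemma cen_uniq u v : u - v \is a Num.int -> `|v| < 2^-1 -> cen u = v.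
Proof.
move=> uv v2; apply/eqP; rewrite -subr_eq0; apply/eqP/intr_small.
  have -> : cen u - v = (u - v) - (u - cen u) by ring.
  by rewrite rpredB// cen_mod.
by move: v2; have := cen_ge u; have := cen_lt u; rewrite !ltr_norml; lra.
Qed.

Lemma ang_ge0 w : 0 <= ang w.
Proof. by case: w => [[k [t /= /andP[/ltW]]]|]. Qed.

Lemma ang_lt1 w : ang w < 1.
Proof. by case: w => [[k [t /= /andP[]]]|]. Qed.

Lemma ang_eq0 w : ang w = 0 -> w = None.
Proof. by case: w => [[k [t t01]]|]//= te; exfalso; have /andP[] := t01; rewrite te ltxx. Qed.

Lemma ang_circ_inj w w' : ang w = ang w' -> circ w = circ w' -> w = w'.
Proof.
by case: w w' => [[k s]|] [[l t]|]//= /val_inj -> // [->].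
Qed.

Lemma ang_mod_inj w w' : ang w - ang w' \is a Num.int -> ang w = ang w'.
Proof.
move=> h; apply/eqP; rewrite -subr_eq0; apply/eqP/(intr_small h).
have := ang_ge0 w; have := ang_ge0 w'; have := ang_lt1 w; have := ang_lt1 w'.
by rewrite ltr_norml; lra.
Qed.

Lemma ang_wpt k u : ang (wpt k u) - u \is a Num.int.
Proof.
rewrite /wpt; case: insubP => [[t t01]/= _ ->|/=].
  by rewrite addrC addKr rpredN intr_int.
have := Num.Theory.floor_le u; have := floorD1_gt u; rewrite intrD => u1 u0.
rewrite negb_and -!leNgt => h.
have -> : 0 - u = - (Num.floor u)%:~R by case/orP: h; lra.
by rewrite rpredN intr_int.
Qed.

Lemma wptE k u (u01 : 0 < u < 1) : wpt k u = Some (k, exist _ u u01).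
Proof.
rewrite /wpt; have -> : Num.floor u = 0.
  by apply/floor_def; rewrite /= (ltW (proj1 (andP u01))) add0r; case/andP: u01.
rewrite subr0 insubT //=.
Qed.

Lemma edist_gt0 (t : {t : R | 0 < t < 1}) : 0 < Defs.edist (val t).
Proof. by case: t => t /= t01; rewrite /Defs.edist lt_min; lra. Qed.

Ltac wd := rewrite /Defs.edist /Num.min /=; repeat (case: ifPn); rewrite -?leNgt; lra.
Ltac norml := repeat match goal with |- context [ `|?x| ] =>
   lazymatch x with context [ `|_| ] => fail | _ => case: (ger0P x) end end.

Lemma wdistC w w' : wdist w w' = wdist w' w.
Proof.
case: w w' => [[k s]|] [[l t]|]//=; rewrite eq_sym; case: eqP => _.
  by rewrite distrC.
by rewrite addrC.
Qed.

Lemma wdist_gt0 w w' : w <> w' -> 0 < wdist w w'.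
Proof.
case: w w' => [[k s]|] [[l t]|]//= h; last 2 first.
- exact: edist_gt0.
- exact: edist_gt0.
case: eqP h => [->|_] h; last by rewrite addr_gt0 ?edist_gt0.
have st : val s != val t by apply/eqP => /val_inj e; apply: h; rewrite e.
rewrite lt_min normr_gt0 subr_eq0 st /=.
case: s t {h st} => s /= s01 [t /= t01].
by rewrite subr_gt0 ltr_norml; lra.
Qed.

Lemma wdist_triangle w2 w1 w3 : wdist w1 w3 <= wdist w1 w2 + wdist w2 w3.
Proof.
case: w1 w2 w3 => [[k [s s01]]|] [[l [t t01]]|] [[m [r r01]]|] //=;
 repeat (case: eqP => ?); subst => //; norml; try (by []); wd.
Qed.

Lemma cen_le u v : u - v \is a Num.int -> `|cen u| <= `|v|.
Proof.
move=> uv; have [v2|v2] := ltP `|v| 2^-1; first by rewrite (cen_uniq uv v2).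
by apply: le_trans v2; rewrite ler_norml cen_ge ltW// cen_lt.
Qed.

Lemma cen_le_bound v u c : `|v| <= c -> u - v \is a Num.int -> `|cen u| <= c.
Proof. by move=> vc uv; apply: le_trans (cen_le uv) vc. Qed.

(** Folding all circles onto R/Z does not increase distances, and [|cen|] of a difference is the
    distance in R/Z. *)
Lemma cen_ang_le w w' : `|cen (ang w - ang w')| <= wdist w w'.
Proof.
have int1 u v : u - v = 1 -> u - v \is a Num.int by move=> ->; rewrite rpred1.
have intN1 u v : u - v = - 1 -> u - v \is a Num.int by move=> ->; rewrite rpredN1.
have int0 u : u - u \is a Num.int by rewrite subrr rpred0.
have edist_cen (t : {t : R | 0 < t < 1}) : `|cen (val t)| <= Defs.edist (val t) /\
     `|cen (- val t)| <= Defs.edist (val t).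
  case: t => t /= t01; rewrite /Defs.edist minElt; case: ifP => t2; split.
  - by apply: (cen_le_bound (v := t)); rewrite // ler_norml; lra.
  - by apply: (cen_le_bound (v := - t)); rewrite // ler_norml; lra.
  - by apply: (cen_le_bound (v := t - 1)); [rewrite ler_norml|apply: int1]; lra.
  - by apply: (cen_le_bound (v := 1 - t)); [rewrite ler_norml|apply: intN1]; lra.
case: w w' => [[k s]|] [[l t]|] /=.
- case: eqP => _.
    rewrite le_min cen_le//=.
    case: s t => s /= s01 [t /= t01].
    have [st|st] := ger0P (s - t).
      by apply: (cen_le_bound (v := s - t - 1)); [rewrite ler_norml|apply: int1]; lra.
    by apply: (cen_le_bound (v := s - t + 1)); [rewrite ler_norml|apply: intN1]; lra.
  have [s1 _] := edist_cen s; have [_ t2] := edist_cen t.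
  (* Points of different circles are joined through the wedge point, so their centred angles add. *)
  apply: (cen_le_bound (v := cen (val s) + cen (- val t))).
    by apply: le_trans (lerD s1 t2); apply: ler_normD.
  have -> : val s - val t - (cen (val s) + cen (- val t)) =
    (val s - cen (val s)) + (- val t - cen (- val t)) by ring.
  by rewrite rpredD ?cen_mod.
- by rewrite subr0; case: (edist_cen s).
- by rewrite sub0r; case: (edist_cen t).
- by apply: (cen_le_bound (v := 0)); rewrite ?normr0 ?subrr ?rpred0.
Qed.

(** It vanishes only at the wedge point and separates circle [j] from the others by its sign, so the
    intermediate value theorem detects a change of circle. *)
Definition tent (j : nat) w : R :=
  if w is Some (k, t) then (if k == j then Defs.edist (val t) else - Defs.edist (val t)) else 0.

Lemma tent_lip j w w' : `|tent j w - tent j w'| <= wdist w w'.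
Proof.
case: w w' => [[k [s s01]]|] [[l [t t01]]|] //=; rewrite ?subrr ?normr0//;
 repeat (case: eqP => ?); subst => //; rewrite ler_norml;  norml; try (by []); wd.
Qed.

(** A path leaving circle [k] must pass the wedge point, which is already at distance [edist t]. *)
Lemma circ_near k t t01 w : wdist (Some (k, exist _ t t01)) w < Defs.edist t -> circ w = Some k.
Proof.
case: w => [[l [s s01]]|] /=; last by rewrite ltxx.
case: eqP => [->//|_] h2; exfalso.
by move: h2; have := @edist_gt0 (exist _ s s01); rewrite /=; lra.
Qed.

End Wedge.

(** * Compactness and monotone functions *)

Section Compactness.
Variables (R : realType) (X : topologicalType).
Hypothesis cX : compact [set: X].

(** Compactness in near-covering form along the filter of small positive reals. [P] is not assumed
    monotone in [e], so the local hypothesis speaks of all small [e]. *)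
Lemma compact_uniform_eps (P : R -> X -> Prop) :
  (forall x : X, exists2 d : R, 0 < d & \forall y \near x, forall e, 0 < e < d -> P e y) ->
  exists2 e : R, 0 < e & forall x, P e x.
Proof.
move=> h; have /compact_near_coveringP cov := cX.
have : \forall e \near 0^'+, [set: X] `<=` P e.
  apply: cov => x _; have [d d0 hd] := h x.
  exists ([set y | forall e, 0 < e < d -> P e y], [set e | 0 < e < d]).
    split=> //=; near=> e; apply/andP; split; last by near: e; exact: nbhs_right_lt.
    by near: e; exact: nbhs_right_gt.
  by move=> [y e] /= [hy he]; exact: hy.
move=> hn; near (0 : R)^'+ => e.
have e0 : 0 < e by near: e; exact: nbhs_right_gt.
have Pe : [set: X] `<=` P e by near: e.
by exists e => // x; exact: Pe.
Unshelve. all: by end_near. Qed.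

Lemma compact_uniform_nat (P : nat -> X -> Prop) :
  (forall x : X, exists N, \forall y \near x, forall i, (N <= i)%N -> P i y) ->
  exists N, forall i, (N <= i)%N -> forall x, P i x.
Proof.
move=> h; have /compact_near_coveringP cov := cX.
have : \forall i \near \oo, [set: X] `<=` P i.
  apply: cov => x _; have [N hN] := h x.
  exists ([set y | forall i, (N <= i)%N -> P i y], [set i | (N <= i)%N]).
    by split=> //=; exact: nbhs_infty_ge.
  by move=> [y e] /= [hy he]; exact: hy.
by move=> [N _ hN]; exists N => i Ni x; exact: hN.
Qed.

End Compactness.

Section RealLemmas.
Variable R : realType.

(** Real induction: continuity puts the supremum of the good set [S] into [S], and the hypothesis
    then pushes beyond it. *)
Lemma right_local_ndecr (f : R -> R) : continuous f ->
  (forall u, exists2 d : R, 0 < d & forall v, 0 < v < d -> f u <= f (u + v)) ->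
  forall u u', u <= u' -> f u <= f u'.
Proof.
move=> cf loc u u' uu'; rewrite leNgt; apply/negP => fu.
pose S := [set t | u <= t <= u' /\ f u <= f t].
have Su : S u by split; rewrite ?lexx.
have hS : has_sup S by split; [exists u|exists u' => t [/andP[]]].
have Sub t : S t -> t <= sup S by move=> St; apply: ub_le_sup => //; case: hS.
have supu' : sup S <= u' by apply: ge_sup; [exists u|move=> t [/andP[]]].
have usup := Sub _ Su.
have fsup : f u <= f (sup S).
  rewrite leNgt; apply/negP => fs.
  have /nbhs_ballP[e /= e0 he] : \forall t \near sup S, f t < f u.
    exact: (cvgr_lt (f (sup S)) (cf (sup S)) _ fs).
  have [t St te] := sup_adherent e0 hS.
  have ts := Sub _ St.
  have : f t < f u by apply: he; rewrite /ball /= ger0_norm; lra.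
  by rewrite ltNge; case: St => _ ->.
have sup_lt : sup S < u'.
  rewrite lt_neqAle supu' andbT; apply/eqP => e; move: fsup; rewrite e leNgt fu.
  by [].
have [d d0 hd] := loc (sup S).
pose v := Num.min (d / 2) ((u' - sup S) / 2).
have v0 : 0 < v by rewrite lt_min; apply/andP; split; lra.
have vd : v <= d / 2 by rewrite ge_min lexx.
have vu : v <= (u' - sup S) / 2 by rewrite ge_min lexx orbT.
suff /Sub : S (sup S + v) by lra.
split; first lra.
by apply: le_trans fsup _; apply: hd; lra.
Qed.

Lemma right_local_incr (f : R -> R) : continuous f ->
  (forall u, exists2 d : R, 0 < d & forall v, 0 < v < d -> f u < f (u + v)) ->
  forall u u', u < u' -> f u < f u'.
Proof.
move=> cf loc u u' uu'; have [d d0 hd] := loc u.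
have ndec := right_local_ndecr cf.
pose v := Num.min (d / 2) (u' - u).
have v0 : 0 < v by rewrite lt_min; apply/andP; split; lra.
have vd : v <= d / 2 by rewrite ge_min lexx.
have vu : v <= (u' - u) by rewrite ge_min lexx orbT.
apply: (lt_le_trans (hd v _)); first lra.
apply: ndec; last lra.
move=> t; have [e e0 he] := loc t; exists e => // w we; exact/ltW/he.
Qed.

(** The strict signs of [f x] at [z x - e] and [z x + e] persist for nearby parameters, and
    monotonicity traps the zero between them. *)
Lemma zero_continuous (T : topologicalType) (f : T -> R -> R) (z : T -> R) :
  (forall x s s', s < s' -> f x s < f x s') ->
  (forall s, continuous (f^~ s)) -> (forall x, f x (z x) = 0) -> continuous z.
Proof.
move=> finc fc fz x; apply/cvgrPdist_lt => e e0.
have h1 : f x (z x - e) < 0 by rewrite -(fz x); apply: finc; lra.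
have h2 : 0 < f x (z x + e) by rewrite -(fz x); apply: finc; lra.
have n1 : \forall y \near x, f y (z x - e) < 0.
  exact: (cvgr_lt _ (fc _ x) _ h1).
have n2 : \forall y \near x, 0 < f y (z x + e).
  exact: (cvgr_gt _ (fc _ x) _ h2).
near=> y.
have k1 : f y (z x - e) < 0 by near: y.
have k2 : 0 < f y (z x + e) by near: y.
have mono s s' : f y s < f y s' -> s < s'.
  move=> ss; rewrite ltNge le_eqVlt; apply/negP => /orP[/eqP ee|/(finc y)]; last lra.
  by rewrite ee ltxx in ss.
rewrite -(fz y) in k1; rewrite -(fz y) in k2.
by rewrite ltr_norml; have := mono _ _ k1; have := mono _ _ k2; lra.
Unshelve. all: by end_near. Qed.

Lemma ivt_zero (f : R -> R) (a b : R) : continuous f -> f a <= 0 <= f b ->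
  exists2 c, Num.min a b <= c <= Num.max a b & f c = 0.
Proof.
move=> cf /andP[fa fb]; have [ab|/ltW ab] := leP a b.
  have [|c] := @IVT R f a b 0 ab (continuous_subspaceT cf).
    by rewrite ge_min le_max fa fb orbT.
  by rewrite in_itv /= => ? ?; exists c.
have [|c] := @IVT R f b a 0 ab (continuous_subspaceT cf).
  by rewrite ge_min le_max fa fb orbT.
by rewrite in_itv /= => ? ?; exists c.
Qed.

End RealLemmas.

(** * The angle cocycle of a projection *)

Section Cocycle.
Variables (R : realType) (X : topologicalType) (phi : R -> X -> X).

(** [D x s] is the total turning of [p] along the orbit of [x] during time [s], a real lift of a
    difference of angles in R/Z. *)
Definition angle_cocycle (p : X -> wpoint R) (D : X -> R -> R) : Prop :=
  [/\ continuous (fun z : X * R => D z.1 z.2),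
      forall x s t, D x (s + t) = D x s + D (phi s x) t,
      forall x s t, s < t -> D x s < D x t,
      forall x u, exists s, D x s = u &
      forall x s, ang (p (phi s x)) - ang (p x) - D x s \is a Num.int].

Hypotheses (fl : is_flow phi) (cX : compact [set: X]).

Lemma flow0 x : phi 0 x = x. Proof. by case: fl. Qed.

Lemma flowD s t x : phi (s + t) x = phi t (phi s x).
Proof. by rewrite addrC; case: fl. Qed.

Lemma flow_cvg (T : Type) (F : set_system T) {FF : Filter F} (f : T -> R) (g : T -> X)
    (s : R) (x : X) :
  f t @[t --> F] --> s -> g t @[t --> F] --> x -> phi (f t) (g t) @[t --> F] --> phi s x.
Proof.
move=> fs gx; case: fl => cphi _ _; exact: (continuous2_cvg _ (h := phi) (cphi (s, x)) fs gx).
Qed.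

Lemma flow_continuous_time x : continuous (phi ^~ x).
Proof. by move=> s; apply: flow_cvg; [exact: cvg_id|exact: cvg_cst]. Qed.

Variables (n : nat) (p : X -> wpoint R).
Hypothesis pp : projection phi n p.

Lemma proj_near (T : Type) (F : set_system T) {FF : Filter F} (g : T -> X) x (e : R) :
  g t @[t --> F] --> x -> 0 < e -> \forall t \near F, wdist (p x) (p (g t)) < e.
Proof. by case: pp => _ cp _ _ gx e0; exact: (gx _ (cp x e e0)). Qed.

Lemma proj_near_id (x : X) (e : R) : 0 < e -> \forall y \near x, wdist (p x) (p y) < e.
Proof. by case: pp => _ cp _ _; exact: cp. Qed.

Lemma proj_near_path (x : X) (t e : R) : 0 < e ->
  \forall t' \near t, wdist (p (phi t x)) (p (phi t' x)) < e.
Proof.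
move=> e0; apply: (@proj_near _ (nbhs t) _ (phi ^~ x)) => //.
exact: flow_continuous_time.
Qed.

Let step x s := cen (ang (p (phi s x)) - ang (p x)).

Lemma step_mod x s : ang (p (phi s x)) - ang (p x) - step x s \is a Num.int.
Proof. exact: cen_mod. Qed.

(** With the bound 1/8, a sum of up to four steps stays within 1/2, so congruences modulo 1 between
    steps become equalities. *)
Lemma step_small : exists2 e : R, 0 < e &
  forall x s, `|s| <= e -> `|step x s| < 8^-1.
Proof.
apply: (compact_uniform_eps cX) => x.
have : \forall z \near ((0 : R), x), wdist (p x) (p (phi z.1 z.2)) < 16^-1.
  have := @proj_near _ (nbhs ((0 : R), x)) _ (fun z => phi z.1 z.2) (phi 0 x) 16^-1.
  rewrite flow0; apply; last lra.
  by rewrite -{2}(flow0 x); apply: flow_cvg; [exact: cvg_fst|exact: cvg_snd].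
move=> [[A B]/= [/nbhs_ballP[d /= d0 hd] Bx] AB]; exists d => //.
near=> y => e /andP[e0 ed] s se.
have By : B y by near: y.
have h1 : wdist (p x) (p (phi s y)) < 16^-1.
  by apply: (AB (s, y)); split=> //=; apply: hd; rewrite /ball /= sub0r normrN; lra.
have h2 : wdist (p x) (p y) < 16^-1 by near: y; apply: (proj_near cvg_id); lra.
apply: le_lt_trans (cen_ang_le _ _) _.
have := wdist_triangle (p x) (p (phi s y)) (p y).
by rewrite (wdistC _ (p x)); lra.
Unshelve. all: by end_near. Qed.

Section Doubling.
Variable e : R.
Hypotheses (e0 : 0 < e) (se : forall x s, `|s| <= e -> `|step x s| < 8^-1).

Lemma step_add x s t : `|s| <= e -> `|t| <= e -> `|s + t| <= e ->
  step x (s + t) = step x s + step (phi s x) t.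
Proof.
move=> hs ht hst; apply: cen_uniq.
  rewrite flowD; apply: (int_eq (rpredD (step_mod x s) (step_mod (phi s x) t))); ring.
apply: le_lt_trans (ler_normD _ _) _.
by have := se x hs; have := se (phi s x) ht; lra.
Qed.

(** [cen] jumps at 1/2, but [step] keeps below 1/8 here; the change of [step] is thus exactly the
    difference of the two small angle changes. *)
Lemma step_cont x s : `|s| < e -> step z.1 z.2 @[z --> (x, s)] --> step x s.
Proof.
move=> hs; apply/cvgrPdist_lt => a a0.
pose b := Num.min (a / 4) 8^-1.
have b0 : 0 < b by rewrite lt_min; apply/andP; split; lra.
have ba : b <= a / 4 by rewrite ge_min lexx.
have b8 : b <= 8^-1 by rewrite ge_min lexx orbT.
near=> z.
have hz : `|z.2| <= e.
  by apply: ltW; near: z; apply: (cvgr_norm_lt s _ _ hs); exact: cvg_snd.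
have h1 : wdist (p (phi s x)) (p (phi z.2 z.1)) < b.
  by near: z; apply: proj_near => //; apply: flow_cvg; [exact: cvg_snd|exact: cvg_fst].
have h2 : wdist (p x) (p z.1) < b.
  by near: z; apply: proj_near => //; exact: cvg_fst.
have k1 := le_lt_trans (cen_ang_le _ _) h1; have k2 := le_lt_trans (cen_ang_le _ _) h2.
have m1 := cen_mod (ang (p (phi s x)) - ang (p (phi z.2 z.1))).
have m2 := cen_mod (ang (p x) - ang (p z.1)).
move: k1 k2 m1 m2; set d1 := cen _; set d2 := cen _ => k1 k2 m1 m2.
have e1 : step x s - step z.1 z.2 - (d1 - d2) = 0.
  apply: intr_small.
    have -> : step x s - step z.1 z.2 - (d1 - d2) =
      (ang (p (phi z.2 z.1)) - ang (p z.1) - step z.1 z.2) -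
      (ang (p (phi s x)) - ang (p x) - step x s) +
      ((ang (p (phi s x)) - ang (p (phi z.2 z.1))) - d1) - ((ang (p x) - ang (p z.1)) - d2) by ring.
    by rewrite rpredB// rpredD// rpredB// step_mod.
  have := se z.1 hz; have := se x (ltW hs).
  by move: k1 k2; rewrite !ltr_norml; lra.
have -> : step x s - step z.1 z.2 = d1 - d2 by lra.
by move: k1 k2; rewrite !ltr_norml; lra.
Unshelve. all: by end_near. Qed.

(* Extends the additive local lift [step] from [|s| <= e] to [|s| <= 2 ^ j * e]. *)
Fixpoint dbl j x s : R :=
  if j is j'.+1 then dbl j' x (s / 2) + dbl j' (phi (s / 2) x) (s / 2) else step x s.

Let half_normE (s : R) : `|s / 2| = `|s| / 2.
Proof. by rewrite normrM [X in _ * X]gtr0_norm ?invr_gt0. Qed.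

Let half_norm (s : R) j : `|s| <= 2 ^+ j.+1 * e -> `|s / 2| <= 2 ^+ j * e.
Proof. by rewrite half_normE exprS; lra. Qed.

Lemma dbl_stable j x s : `|s| <= 2 ^+ j * e -> dbl j.+1 x s = dbl j x s.
Proof.
elim: j x s => [|j IH] x s hs; last first.
  by apply: (congr2 +%R); apply: IH; exact: half_norm.
rewrite expr0 mul1r in hs.
have h2 : `|s / 2| <= e.
  rewrite half_normE; have := normr_ge0 s; lra.
have h1 : s / 2 + s / 2 = s by lra.
by rewrite /= -step_add ?h1.
Qed.

Lemma dbl_le i j x s : (i <= j)%N -> `|s| <= 2 ^+ i * e -> dbl j x s = dbl i x s.
Proof.
move=> /subnK <- hs; elim: (j - i)%N => // k IH.
rewrite addSn dbl_stable ?IH//; apply: le_trans hs _.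
by rewrite ler_pM2r// ler_eXn2l ?ltr1n// leq_addl.
Qed.

Lemma dbl_add j x s t : `|s| + `|t| <= 2 ^+ j * e ->
  dbl j x (s + t) = dbl j x s + dbl j (phi s x) t.
Proof.
elim: j x s t => [|j IH] x s t hst.
  rewrite expr0 mul1r in hst.
  have := normr_ge0 s; have := normr_ge0 t; have := ler_normD s t.
  by move=> h1 h2 h3; rewrite /= step_add//; lra.
have hst2 : `|s / 2| + `|t / 2| <= 2 ^+ j * e.
  by move: hst; rewrite !half_normE exprS; lra.
rewrite /= (_ : (s + t) / 2 = s / 2 + t / 2); last by rewrite mulrDl.
rewrite !IH// -!flowD.
(* The induction hypothesis gives quarters in the order s, t, s, t; the middle two must be
   exchanged. *)
have e1 : forall y, dbl j y (t / 2) + dbl j (phi (t / 2) y) (s / 2) =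
   dbl j y (s / 2) + dbl j (phi (s / 2) y) (t / 2).
  by move=> y; rewrite -!IH// 1?addrC.
have := e1 (phi (s / 2) x); rewrite -!flowD.
have -> : s / 2 + s / 2 = s by lra.
have -> : s / 2 + t / 2 + s / 2 = s + t / 2 by lra.
by lra.
Qed.

Lemma dbl_mod j x s : ang (p (phi s x)) - ang (p x) - dbl j x s \is a Num.int.
Proof.
elim: j x s => [|j IH] x s; first exact: step_mod.
have h1 := IH x (s / 2); have h2 := IH (phi (s / 2) x) (s / 2).
rewrite -flowD (_ : s / 2 + s / 2 = s) in h2; last lra.
by rewrite /=; apply: (int_eq (rpredD h1 h2)); ring.
Qed.

Lemma dbl_cont j x s : `|s| < 2 ^+ j * e -> dbl j z.1 z.2 @[z --> (x, s)] --> dbl j x s.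
Proof.
elim: j x s => [|j IH] x s; first by rewrite expr0 mul1r; exact: step_cont.
move=> hs; have hs2 : `|s / 2| < 2 ^+ j * e.
  by move: hs; rewrite half_normE exprS; lra.
have c2 : z.2 / 2 @[z --> (x, s)] --> s / 2 by apply: cvgMl; exact: cvg_snd.
apply: cvgD; first by apply: (continuous2_cvg _ (h := dbl j) (IH _ _ hs2) _ c2); exact: cvg_fst.
apply: (continuous2_cvg _ (h := dbl j) (IH (phi (s / 2) x) _ hs2) _ c2).
by apply: flow_cvg => //; exact: cvg_fst.
Qed.

Let lev (s : R) := Num.bound (`|s| / e).

Let levP s : `|s| < 2 ^+ lev s * e.
Proof.
rewrite -ltr_pdivrMr//; apply: (lt_le_trans (archi_boundP _)).
  by rewrite divr_ge0// ltW.
by rewrite -natrX ler_nat ltnW// ltn_expl.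
Qed.

Definition lift_cocycle x s := dbl (lev s) x s.

(** The level used in the definition depends on [s]; values at different times are compared at a
    common higher level. *)
Lemma lift_cocycleE j x s : `|s| <= 2 ^+ j * e -> lift_cocycle x s = dbl j x s.
Proof.
move=> hs; rewrite /lift_cocycle; case: (leqP j (lev s)) => h.
  by rewrite (dbl_le _ h).
by rewrite (dbl_le _ (ltnW h))// ltW.
Qed.

Lemma lift_cocycleD x s t : lift_cocycle x (s + t) = lift_cocycle x s + lift_cocycle (phi s x) t.
Proof.
have := levP (`|s| + `|t|); rewrite [X in X < _]ger0_norm ?addr_ge0//.
move: (lev _) => j /ltW h.
rewrite !(@lift_cocycleE j) ?dbl_add//.
- by apply: le_trans h; rewrite lerDr.
- by apply: le_trans h; rewrite lerDl.
- exact: le_trans (ler_normD _ _) h.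
Qed.

Lemma lift_cocycle_cont : continuous (fun z : X * R => lift_cocycle z.1 z.2).
Proof.
move=> [x s]; suff : lift_cocycle z.1 z.2 @[z --> (x, s)] --> dbl (lev s) x s by [].
apply: cvg_trans (dbl_cont (levP s)); apply: near_eq_cvg.
near=> z; apply/esym/lift_cocycleE/ltW; near: z.
by apply: (cvgr_norm_lt s _ _ (levP s)); exact: cvg_snd.
Unshelve. all: by end_near. Qed.

Lemma lift_cocycle_step x s : `|s| <= e -> lift_cocycle x s = step x s.
Proof. by move=> hs; rewrite (@lift_cocycleE 0)// expr0 mul1r. Qed.

End Doubling.

(* Strictly to the right of [0] the parameter [a] of [pos_at] has no integer jump, and
   there it differs from the continuous [step x] by a constant. *)
Lemma step_gt0 x : exists2 d : R, 0 < d & forall s, 0 < s < d -> 0 < step x s.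
Proof.
have [_ _ _ /(_ x)[d d0 [_ _ [k [a [ga ainc]]]]]] := pp.
have steplim (b : R) : 0 < b -> exists2 d' : R, 0 < d' & forall s, 0 < s < d' -> `|step x s| < b.
  move=> b0; have : \forall t \near (0 : R), wdist (p x) (p (phi t x)) < b.
    apply: (@proj_near _ (nbhs (0 : R)) _ (phi ^~ x)) => //; rewrite -[X in _ --> X](flow0 x).
    exact: flow_continuous_time.
  move=> /nbhs_ballP[d' /= d'0 hd]; exists d' => // s sd.
  apply: le_lt_trans (cen_ang_le _ _) _; rewrite wdistC; apply: hd.
  by rewrite /ball /= sub0r normrN gtr0_norm; lra.
have [d1 d10 hd1] := steplim 8^-1 ltac:(lra).
(* [inf A] replaces [a 0], from which [a] may jump. Up to [s1] the parameter grows by less than 1/4,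
   too little to hide an integer. *)
pose A := [set a s | s in [set s | 0 < s < d]].
have hA : has_inf A.
  split; first by exists (a (d / 2)), (d / 2) => //=; lra.
  by exists (a 0) => _ [s /= sd <-]; apply/ltW/ainc; lra.
have [_ [s1 /= s1d <-] hs1] := @inf_adherent _ A 4^-1 ltac:(lra) hA.
pose d2 := Num.min s1 d1.
have d2s : d2 <= s1 by rewrite ge_min lexx.
have d2d : d2 <= d1 by rewrite ge_min lexx orbT.
have d20 : 0 < d2 by rewrite lt_min; apply/andP; split; lra.
have incr s s' : 0 < s -> s < s' -> s' < d2 -> step x s < step x s'.
  move=> s0 ss' s'd.
  have i1 : inf A <= a s by apply: ge_inf; [case: hA|exists s => //=; lra].
  have i2 : a s' < a s1 by apply: ainc; lra.
  have i3 : a s < a s' by apply: ainc; lra.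
  have k1 := hd1 s ltac:(lra); have k2 := hd1 s' ltac:(lra).
  suff : step x s' - step x s - (a s' - a s) = 0 by lra.
  apply: intr_small; last by move: k1 k2; rewrite !ltr_norml; lra.
  have m1 := step_mod x s; have m2 := step_mod x s'.
  have e1 : p (phi s x) = wpt k (a s) by apply: ga; lra.
  have e2 : p (phi s' x) = wpt k (a s') by apply: ga; lra.
  have n1 := ang_wpt k (a s); have n2 := ang_wpt k (a s').
  rewrite -e1 in n1; rewrite -e2 in n2.
  by apply: (int_eq (rpredB (rpredB m1 m2) (rpredB n1 n2))); ring.
(* A value at most 0 at [s] would force values below a fixed negative number near 0, whereas
   [step x] tends to 0 there. *)
exists d2 => // s sd; rewrite ltNge; apply/negP => h.
have h1 : step x (s / 2) < step x s by apply: incr; lra.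
have [d3 d30 hd3] := steplim (- step x (s / 2)) ltac:(lra).
pose t := Num.min (s / 4) (d3 / 2).
have ts : t <= s / 4 by rewrite ge_min lexx.
have td : t <= d3 / 2 by rewrite ge_min lexx orbT.
have t0 : 0 < t by rewrite lt_min; apply/andP; split; lra.
have h2 : step x t < step x (s / 2) by apply: incr; lra.
by have := hd3 t ltac:(lra); rewrite ltr_norml; lra.
Qed.

(** By the cocycle law, monotonicity need only be checked just to the right of time 0, where it is
    [step_gt0]. *)
Lemma angle_cocycle_exists : exists D, angle_cocycle p D.
Proof.
have [e e0 se] := step_small.
pose D := lift_cocycle e.
have Dc : continuous (fun z : X * R => D z.1 z.2) := lift_cocycle_cont e0 se.
have DD x s t : D x (s + t) = D x s + D (phi s x) t := lift_cocycleD e0 se x s t.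
have Dstep x s : `|s| <= e -> D x s = step x s := @lift_cocycle_step e e0 se x s.
have D0 x : D x 0 = 0 by have := DD x 0 0; rewrite addr0 flow0; lra.
have Dmod x s : ang (p (phi s x)) - ang (p x) - D x s \is a Num.int := dbl_mod _ x s.
have Dcs x : continuous (D x).
  move=> s; apply: (continuous2_cvg _ (h := D) (Dc (x, s))); [exact: cvg_cst|exact: cvg_id].
have Dinc x s t : s < t -> D x s < D x t.
  apply: right_local_incr => // u; have [d d0 hd] := step_gt0 (phi u x).
  exists (Num.min d e) => [|v /andP[v0]]; first by rewrite lt_min d0.
  rewrite lt_min => /andP[vd ve]; rewrite DD ltrDl Dstep ?hd ?v0//.
  by rewrite gtr0_norm// ltW.
exists D; split => // x u.
(* For surjectivity: the turning during time [e] has a positive minimum [b] on the compact space, so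
   [k] such periods turn by at least [k * b]. *)
have De : {within [set: X], continuous (D ^~ e)}.
  apply: continuous_subspaceT => y.
  by apply: (continuous2_cvg _ (h := D) (Dc (y, e))); [exact: cvg_id|exact: cvg_cst].
have [c _ hc] := compact_EVT_min (ex_intro _ x I) cX De.
pose b := D c e; have b0 : 0 < b by rewrite -(D0 c) /b; exact: Dinc.
have hb y : b <= D y e by apply: hc; rewrite inE.
have up y k : k%:R * b <= D y (k%:R * e).
  elim: k y => [|k IH] y; first by rewrite !mul0r D0.
  by rewrite -natr1 !mulrDl !mul1r DD lerD.
have dn y k : D y (- (k%:R * e)) <= - (k%:R * b).
  have := up (phi (- (k%:R * e)) y) k.
  by have := DD y (- (k%:R * e)) (k%:R * e); rewrite addNr D0; lra.
pose k := Num.bound (`|u| / b).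
have ku : `|u| < k%:R * b.
  by rewrite -ltr_pdivrMr// archi_boundP// divr_ge0// ltW.
have [||c' _ hc'] := @ivt_zero _ (fun s => D x s - u) (- (k%:R * e)) (k%:R * e).
- by move=> s; apply: cvgB; [exact: Dcs|exact: cvg_cst].
- have := up x k; have := dn x k; move: ku; rewrite ltr_norml; lra.
by exists c'; lra.
Qed.

End Cocycle.

(** * Local structure of projections *)

Section Paths.
Variable R : realType.

(** If the circles differed, [tent] would change sign along the path and vanish somewhere, at the
    wedge point. *)
Lemma circ_path (g : R -> wpoint R) (u v : R) :
  (forall (t e : R), 0 < e -> \forall t' \near t, wdist (g t) (g t') < e) ->
  (forall t, Num.min u v <= t <= Num.max u v -> g t <> None) -> circ (g u) = circ (g v).
Proof.
move=> gc gn; case gu : (g u) => [[j t]|]; last first.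
  by case: (gn u) => //; rewrite ge_min le_max lexx.
case gv : (g v) => [[k s]|]; last first.
  by case: (gn v) => //; rewrite ge_min le_max lexx !orbT.
apply/eqP; rewrite /= (inj_eq Some_inj) eq_sym; apply: contraT => kj.
have [||c cuv hc] := @ivt_zero R (fun t => tent j (g t)) v u.
- move=> x; apply/cvgrPdist_lt => e e0; near=> y.
  by apply: le_lt_trans (tent_lip _ _ _) _; near: y; exact: gc.
- rewrite gu gv /= eqxx (negbTE kj).
  by have := edist_gt0 t; have := edist_gt0 s; lra.
rewrite minC maxC in cuv; case gc' : (g c) (gn c cuv) => [[l r]|//] _.
by move: hc; rewrite gc' /=; have := edist_gt0 r; case: ifP; lra.
Unshelve. all: by end_near. Qed.

End Paths.

Section CocycleTheory.
Variables (R : realType) (X : topologicalType) (phi : R -> X -> X).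
Hypothesis fl : is_flow phi.
Variables (n : nat) (p : X -> wpoint R) (D : X -> R -> R).
Hypotheses (pp : projection phi n p) (cD : angle_cocycle phi p D).

Lemma cocycle_cvg (T : Type) (F : set_system T) {FF : Filter F} (f : T -> R) (g : T -> X)
    (s : R) (x : X) :
  g t @[t --> F] --> x -> f t @[t --> F] --> s -> D (g t) (f t) @[t --> F] --> D x s.
Proof.
by move=> gx fs; case: cD => Dc _ _ _ _; exact: (continuous2_cvg _ (h := D) (Dc (x, s)) gx fs).
Qed.

Lemma cocycleD x s t : D x (s + t) = D x s + D (phi s x) t. Proof. by case: cD. Qed.

Lemma cocycle0 x : D x 0 = 0.
Proof. by have := cocycleD x 0 0; rewrite addr0 (flow0 fl); lra. Qed.

Lemma cocycle_lt x s t : (D x s < D x t) = (s < t).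
Proof.
have Dinc s' t' : s' < t' -> D x s' < D x t' by case: cD => _ _ h _ _; exact: h.
case: (ltrgtP s t) => [/Dinc//|/Dinc|->]; last exact: ltxx.
by move=> h; apply/negbTE; rewrite -leNgt ltW.
Qed.

Lemma cocycle_gt0 x s : (0 < D x s) = (0 < s).
Proof. by rewrite -[X in X < _](cocycle0 x) cocycle_lt. Qed.

Lemma cocycle_lt0 x s : (D x s < 0) = (s < 0).
Proof. by rewrite -[X in _ < X](cocycle0 x) cocycle_lt. Qed.

Lemma cocycle_inj x : injective (D x).
Proof.
move=> s t st; have h1 := cocycle_lt x s t; have h2 := cocycle_lt x t s.
by apply: le_anti; rewrite !leNgt -h1 -h2 st ltxx.
Qed.

Lemma cocycle_mod x s : ang (p (phi s x)) - ang (p x) - D x s \is a Num.int.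
Proof. by case: cD. Qed.

(** [I x u] is the time in which [p] turns by [u] from [x]. *)
Lemma cocycle_inverse : exists I : X -> R -> R,
  (forall x u, D x (I x u) = u) /\ continuous (fun z : X * R => I z.1 z.2).
Proof.
have h : forall z : X * R, {s | D z.1 s = z.2}.
  by case: cD => _ _ _ Ds _ z; exact: cid.
exists (fun x u => sval (h (x, u))); split=> [x u|]; first exact: (svalP (h (x, u))).
apply: (@zero_continuous _ _ (fun z s => D z.1 s - z.2)) => [x s s' ss'|s z|z].
- by rewrite ltrD2r cocycle_lt.
- apply: cvgB; last exact: cvg_snd.
  by apply: cocycle_cvg; [exact: cvg_fst|exact: cvg_cst].
- by rewrite -surjective_pairing (svalP (h z)) subrr.
Qed.

(* Following the flow for time [s1] keeps both orbits off the wedge point, so they lie on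
   the same circle at the start because they do so at the end. *)
Lemma branch_near (a : X) (s1 : R) : p a = None -> s1 != 0 -> `|D a s1| < 4^-1 ->
  \forall x \near a, forall w, `|w| < 4^-1 -> 0 < w * s1 -> ang (p x) - w \is a Num.int ->
    circ (p x) = circ (p (phi s1 a)).
Proof.
move=> pa s10 Da.
case ps : (p (phi s1 a)) => [[k [t t01]]|]; last first.
  exfalso; move/eqP: s10; apply; apply: (@cocycle_inj a); rewrite cocycle0.
  apply: intr_small; last by apply: lt_trans Da _; lra.
  by have := cocycle_mod a s1; rewrite ps pa subrr sub0r rpredN.
near=> x => w w4 ws wi.
have px1 : circ (p (phi s1 x)) = Some k.
  apply: (@circ_near _ k t t01); rewrite -ps; near: x.
  apply: (proj_near pp); last by have := edist_gt0 (exist _ t t01).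
  by apply: (flow_cvg fl); [exact: cvg_cst|exact: cvg_id].
have Dx1 : `|D x s1| < 4^-1.
  near: x; apply: (cvgr_norm_lt (D a s1)) => //.
  by apply: cocycle_cvg; [exact: cvg_id|exact: cvg_cst].
rewrite /= -px1 -{1}(flow0 fl x).
apply: (@circ_path _ (fun t => p (phi t x))) => [t' e e0|v vs pv].
  exact: (proj_near_path fl pp).
(* A visit to the wedge point at time [v] makes this sum an integer smaller than 1; but [w] is
   nonzero and [D x v] cannot have the opposite sign. *)
have wD : w + D x v = 0.
  apply: intr_small.
    have := cocycle_mod x v; rewrite pv sub0r => hv.
    have := rpredN _ (w + D x v); move=> <-.
    by apply: (int_eq (rpredD hv wi)); ring.
  move: vs Dx1; rewrite minElt maxElt; case: ifP => s1p /andP[v1 v2].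
    have : D x v <= D x s1 by rewrite leNgt cocycle_lt -leNgt.
    have : D x 0 <= D x v by rewrite leNgt cocycle_lt -leNgt.
    by rewrite cocycle0; move: w4; rewrite !ltr_norml; lra.
  have : D x s1 <= D x v by rewrite leNgt cocycle_lt -leNgt.
  have : D x v <= D x 0 by rewrite leNgt cocycle_lt -leNgt.
  by rewrite cocycle0; move: w4; rewrite !ltr_norml; lra.
move: vs; rewrite minElt maxElt; case: ifP => s1p /andP[v1 v2].
  have : D x 0 <= D x v by rewrite leNgt cocycle_lt -leNgt.
  by rewrite pmulr_lgt0 in ws => //; rewrite cocycle0; lra.
have : D x v <= D x 0 by rewrite leNgt cocycle_lt -leNgt.
have s1n : s1 < 0 by rewrite lt_neqAle s10 leNgt s1p.
by rewrite nmulr_lgt0 in ws => //; rewrite cocycle0; lra.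
Unshelve. all: by end_near. Qed.

Lemma cen_ang_near (a : X) (e : R) : 0 < e ->
  \forall x \near a, `|cen (ang (p x) - ang (p a))| < e.
Proof.
move=> e0; near=> x; apply: le_lt_trans (cen_ang_le _ _) _; rewrite wdistC; near: x.
exact: (proj_near_id pp).
Unshelve. all: by end_near. Qed.

(** Let the orbit of [a] turn by the small angle difference between [x] and [a]: the angles then
    agree and only the circles remain to be compared. Off the wedge point the circle is locally
    constant; at the wedge point [branch_near] decides. *)
Lemma near_path (a : X) (e : R) : 0 < e ->
  \forall x \near a, exists2 s, `|s| < e & p x = p (phi s a).
Proof.
suff key : exists2 d : R, 0 < d & \forall x \near a, forall s, `|s| < d ->
    cen (ang (p x) - ang (p a)) = D a s -> circ (p x) = circ (p (phi s a)).
  move=> e0; have [d d0 hd] := key.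
  pose e' := Num.min e d.
  have e'0 : 0 < e' by rewrite lt_min e0.
  have e'e : e' <= e by rewrite ge_min lexx.
  have e'd : e' <= d by rewrite ge_min lexx orbT.
  have De : 0 < D a e' by rewrite cocycle_gt0.
  have DNe : D a (- e') < 0 by rewrite cocycle_lt0 oppr_lt0.
  near=> x.
  have K : forall s, `|s| < d -> cen (ang (p x) - ang (p a)) = D a s ->
    circ (p x) = circ (p (phi s a)) by near: x.
  have w1 : `|cen (ang (p x) - ang (p a))| < D a e' by near: x; exact: cen_ang_near.
  have w2 : `|cen (ang (p x) - ang (p a))| < - D a (- e').
    by near: x; apply: cen_ang_near; lra.
  set w := cen (ang (p x) - ang (p a)) in w1 w2 *.
  have [s Ds] : exists s, D a s = w by case: cD.
  have se' : `|s| < e'.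
    rewrite ltr_norml -(cocycle_lt a (- e')) -(cocycle_lt a s) Ds.
    by move: w1 w2; rewrite !ltr_norml; lra.
  exists s; first lra.
  apply: ang_circ_inj; last by apply: K => //; lra.
  apply: ang_mod_inj.
  have m1 := cen_mod (ang (p x) - ang (p a)); have m2 := cocycle_mod a s.
  by rewrite Ds in m2; apply: (int_eq (rpredB m1 m2)); rewrite -/w; ring.
case pa : (p a) => [[k [t t01]]|].
  have t0 := edist_gt0 (exist _ t t01).
  have := proj_near_path fl pp a 0 t0; rewrite (flow0 fl) pa => /nbhs_ballP[d /= d0 hd].
  exists d => //; near=> x => s sd _.
  rewrite (@circ_near _ k t t01 (p x)).
    apply/esym; apply: (@circ_near _ k t t01); apply: hd.
    by rewrite /ball /= sub0r normrN.
  by rewrite -pa; near: x; exact: (proj_near_id pp).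
have [d1 d10 hd1] : exists2 d1 : R, 0 < d1 & forall s, `|s| < d1 -> `|D a s| < 4^-1.
  have : \forall s \near (0 : R), `|D a s| < 4^-1.
    have cDa : D a s @[s --> (0 : R)] --> D a 0.
      by apply: cocycle_cvg; [exact: cvg_cst|exact: cvg_id].
    by apply: (cvgr_norm_lt _ cDa); rewrite cocycle0 normr0; lra.
  move=> /nbhs_ballP[d /= d0 hd]; exists d => // s sd; apply: hd.
  by rewrite /ball /= sub0r normrN.
(* The sign of [s1] selects the outgoing or the incoming branch. [branch_near] is applied to [x] and
   also to the point [phi s a], and both circles equal that of [phi s1 a]. *)
have pos s1 : s1 != 0 -> `|s1| < d1 -> exists2 d : R, 0 < d & \forall x \near a,
    forall s, `|s| < d -> cen (ang (p x) - ang (p a)) = D a s -> 0 < s * s1 ->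
    circ (p x) = circ (p (phi s a)).
  move=> s10 s1d; have Bn := branch_near pa s10 (hd1 _ s1d).
  have : \forall s \near (0 : R), forall w, `|w| < 4^-1 -> 0 < w * s1 ->
      ang (p (phi s a)) - w \is a Num.int -> circ (p (phi s a)) = circ (p (phi s1 a)).
    have ca : phi s a @[s --> (0 : R)] --> a.
      by rewrite -[X in _ --> X](flow0 fl a); exact: (flow_continuous_time fl).
    exact: (ca _ Bn).
  move=> /nbhs_ballP[d /= d0 hd]; exists (Num.min d d1); first by rewrite lt_min d0.
  near=> x => s; rewrite lt_min => /andP[sd sd1] ws ss1.
  have Ds1 := hd1 s sd1.
  have Dss : 0 < D a s * s1.
    have [s1p|] := ltP 0 s1.
      by move: ss1; rewrite !pmulr_lgt0// cocycle_gt0.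
    rewrite le_eqVlt (negbTE s10) /= => s1n.
    by move: ss1; rewrite !nmulr_lgt0// cocycle_lt0.
  rewrite (hd s _ (D a s))//; last 2 first.
  - by rewrite /ball /= sub0r normrN.
  - by have := cocycle_mod a s; rewrite pa subr0.
  have Bx : forall w, `|w| < 4^-1 -> 0 < w * s1 -> ang (p x) - w \is a Num.int ->
    circ (p x) = circ (p (phi s1 a)) by near: x.
  by apply: (Bx (D a s)) => //; rewrite -ws pa subr0 cen_mod.
have d2 : `|d1 / 2| < d1 by rewrite gtr0_norm; lra.
have d3 : `|- (d1 / 2)| < d1 by rewrite normrN.
have d4 : d1 / 2 != 0 by rewrite gt_eqF ?divr_gt0.
have [e1 e10 h1] := pos _ d4 d2.
have [e2 e20 h2] := pos (- (d1 / 2)) ltac:(by rewrite oppr_eq0) d3.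
exists (Num.min e1 e2); first by rewrite lt_min e10.
near=> x.
have k1 : forall s, `|s| < e1 -> cen (ang (p x) - ang (p a)) = D a s -> 0 < s * (d1 / 2) ->
    circ (p x) = circ (p (phi s a)) by near: x.
have k2 : forall s, `|s| < e2 -> cen (ang (p x) - ang (p a)) = D a s -> 0 < s * - (d1 / 2) ->
    circ (p x) = circ (p (phi s a)) by near: x.
move=> s; rewrite lt_min => /andP[s1 s2] ws.
have [s0|s0|s0] := ltgtP s 0; last first.
- have -> : p x = None.
    apply/ang_eq0; have := cen_mod (ang (p x) - ang (p a)).
    rewrite pa ws s0 cocycle0 !subr0 => /intr_small; apply.
    by rewrite ger0_norm ?ang_ge0 ?ang_lt1.
  by rewrite s0 (flow0 fl) pa.
- by apply: k1; rewrite ?pa// mulr_gt0 ?divr_gt0.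
- by apply: k2; rewrite ?pa// mulrN -mulNr mulr_gt0 ?oppr_gt0 ?divr_gt0.
Unshelve. all: by end_near. Qed.

End CocycleTheory.

(** * Factoring through an expansion *)

Section Reparametrisation.
Variable R : realType.

(** Continuity of [v] at [t0] alone suffices since [pos_at] is local; [time_change] provides it only
    at 0. *)
Lemma pos_at_reparam (gamma g : R -> wpoint R) (v : R -> R) (t0 d : R) :
  0 < d -> (forall t, `|t - t0| < d -> g t = gamma (v t)) ->
  (forall s t, s < t -> v s < v t) -> v t @[t --> t0] --> v t0 ->
  pos_at gamma (v t0) -> pos_at g t0.
Proof.
move=> d0 gE vinc vc [e e0 [inj [k [a [ka ainc]]] [l [b [lb binc]]]]].
have [r [r0 rd hr]] : exists r, [/\ 0 < r, r <= d & forall t, `|t - t0| < r -> `|v t - v t0| < e].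
  have /nbhs_ballP[r /= r0 hr] : \forall t \near t0, `|v t - v t0| < e.
    by near=> t; rewrite distrC; near: t; move/cvgrPdist_lt: vc; apply.
  exists (Num.min r d); split; first by rewrite lt_min r0.
    by rewrite ge_min lexx orbT.
  by move=> t; rewrite lt_min => /andP[tr _]; apply: hr; rewrite /ball /= distrC.
have vle s t : s <= t -> v s <= v t by rewrite le_eqVlt => /orP[/eqP->//|/vinc/ltW].
exists r => //; split.
- move=> s s' sr s'r; rewrite !gE; [|lra..].
  move=> /(inj _ _ (hr _ sr) (hr _ s'r)) vss.
  by case: (ltgtP s s') => // /vinc; rewrite vss ltxx.
- exists k, (a \o v); split=> [s s1 s2|s s' s1 ss' s2] /=.
    rewrite gE; last by rewrite ltr_norml; lra.
    apply: ka; last exact: vle.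
    by have := hr s; rewrite !ltr_norml; lra.
  apply: ainc; [|exact: vinc|exact: vle].
  by have := hr s; rewrite !ltr_norml; lra.
- exists l, (b \o v); split=> [s s1 s2|s s' s1 ss' s2] /=.
    rewrite gE; last by rewrite ltr_norml; lra.
    apply: lb; first exact: vle.
    by have := hr s; rewrite !ltr_norml; lra.
  apply: binc; [exact: vle|exact: vinc|].
  by have := hr s'; rewrite !ltr_norml; lra.
Unshelve. all: by end_near. Qed.

End Reparametrisation.

Section LocalDetermination.
Variables (R : realType) (X : topologicalType) (phi : R -> X -> X).
Hypotheses (fl : is_flow phi) (cX : compact [set: X]).

(** Only pairs near the diagonal are compared: [q] may still differ at distant points of one fibre
    of [p]. *)
Definition locally_determined (q p : X -> wpoint R) : Prop :=
  forall a : X, \forall z \near (a, a), p z.1 = p z.2 -> q z.1 = q z.2.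

(** Both values are attained on an orbit piece of [a] that turns by less than 1/2 to either side,
    and on such a piece the angle determines the time. *)
Lemma near_same_angle n p : projection phi n p ->
  forall a : X, \forall z \near (a, a), ang (p z.1) = ang (p z.2) -> p z.1 = p z.2.
Proof.
move=> pp a; have [D cD] := angle_cocycle_exists fl cX pp.
have : \forall s \near (0 : R), `|D a s| < 2^-1.
  have cDa : D a s @[s --> (0 : R)] --> D a 0.
    by apply: (cocycle_cvg cD); [exact: cvg_cst|exact: cvg_id].
  by apply: (cvgr_norm_lt _ cDa); rewrite (cocycle0 fl cD) normr0; lra.
move=> /nbhs_ballP[d /= d0 hd].
have hn := near_path fl pp cD a d0.
near=> z.
have [s sd es] : exists2 s, `|s| < d & p z.1 = p (phi s a).
  by near: z; exact: (@cvg_fst _ _ (nbhs a) (nbhs a) _ _ hn).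
have [t td et] : exists2 s, `|s| < d & p z.2 = p (phi s a).
  by near: z; exact: (@cvg_snd _ _ (nbhs a) (nbhs a) _ _ hn).
rewrite es et => est; suff -> : s = t by [].
apply: (cocycle_inj cD (x := a)); apply/eqP; rewrite -subr_eq0; apply/eqP/intr_small.
  have m1 := cocycle_mod cD a s; have m2 := cocycle_mod cD a t.
  by rewrite est in m1; apply: (int_eq (rpredB m2 m1)); ring.
have h1 : `|D a s| < 2^-1 by apply: hd; rewrite /ball /= sub0r normrN.
have h2 : `|D a t| < 2^-1 by apply: hd; rewrite /ball /= sub0r normrN.
by apply: le_lt_trans (ler_normB _ _) _; lra.
Unshelve. all: by end_near. Qed.

(** Near [a], the values of [p] are those at times [s] and [t] on the orbit of [a], and then the
    values of [q] are too. As [q] is injective on short orbit pieces, equal values of [q] give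
    [s = t]. *)
Lemma left_factor_determined n m p q (d : wpoint R -> wpoint R) :
  projection phi n p -> projection phi m q -> (forall x, d (p x) = q x) ->
  locally_determined p q.
Proof.
move=> pp pq dpq a; have [D cD] := angle_cocycle_exists fl cX pp.
case: pq => _ _ _ /(_ a)[e e0 [inj _ _]].
have hn := near_path fl pp cD a e0.
near=> z; rewrite -!dpq.
have [s sd es] : exists2 s, `|s| < e & p z.1 = p (phi s a).
  by near: z; exact: (@cvg_fst _ _ (nbhs a) (nbhs a) _ _ hn).
have [t td et] : exists2 s, `|s| < e & p z.2 = p (phi s a).
  by near: z; exact: (@cvg_snd _ _ (nbhs a) (nbhs a) _ _ hn).
rewrite es et !dpq => /inj -> //; by rewrite subr0.
Unshelve. all: by end_near. Qed.

Lemma projection_factor n m (p q : X -> wpoint R) (x0 : X) :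
  projection phi n p -> projection phi m q -> p x0 = None -> q x0 = None ->
  (forall x x', p x = p x' -> q x = q x') ->
  exists u, positive_map n m u /\ forall x, u (p x) = q x.
Proof.
move=> pp pq px0 qx0 pq_fib.
(* The default [x0] is reached only off the image of [p], that is, outside the wedge. *)
pose u w := q (xget x0 [set x | p x = w]).
have up x : u (p x) = q x by apply: pq_fib; case: xgetP => //= /(_ x).
have psurj w : inw n w -> exists x, p x = w by case: pp => _ _ + _; exact.
exists u; split => //; split.
- by move=> w /psurj[x <-]; rewrite up; case: pq => h _ _ _; exact: h.
- by rewrite -[X in u X]px0 up.
- move=> w0 w0n e e0.
  have [|d d0 hd] := @compact_uniform_eps R X cX
    (fun d x => wdist w0 (p x) < d -> wdist (u w0) (q x) < e).
    move=> x; have [pxw|/wdist_gt0 wx] := pselect (p x = w0).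
      exists 1 => //; have := proj_near_id pq x e0.
      by apply: filterS => y hy _ _ _; rewrite -pxw up.
    have w2 : 0 < wdist (p x) w0 / 2 by lra.
    exists (wdist (p x) w0 / 2) => //.
    have := proj_near_id pp x w2; apply: filterS => y hy d dd wd.
    have := wdist_triangle (p y) (p x) w0; rewrite (wdistC (p y) w0); lra.
  by exists d => // w /psurj[x <-]; rewrite up; exact: hd.
- move=> w wm; have [x <-] : exists x, q x = w by case: pq => _ _ + _; exact.
  by exists (p x); [case: pp => h _ _ _; exact: h|exact: up].
- move=> k kn s0 s01.
  (* Over the circle point with parameter [s0] choose [x]; turning its orbit by [s - s0] follows the
     circle, so [u] on the circle is [q] along a reparametrised orbit. *)
  have [x px] := psurj (Some (k, exist _ s0 s01)) kn.
  have [D cD] := angle_cocycle_exists fl cX pp.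
  have [I [DI Ic]] := cocycle_inverse cD.
  have I0 : I x (s0 - s0) = 0.
    by apply: (cocycle_inj cD (x := x)); rewrite DI subrr (cocycle0 fl cD).
  have Icvg : I x (s - s0) @[s --> s0] --> I x (s0 - s0).
    apply: (continuous2_cvg _ (h := I) (Ic (x, s0 - s0))); first exact: cvg_cst.
    by apply: cvgB; [exact: cvg_id|exact: cvg_cst].
  have : \forall s \near s0, `|s0 - s| < Num.min s0 (1 - s0) /\ p (phi (I x (s - s0)) x) = wpt k s.
    near=> s.
    have ss0 : `|s0 - s| < Num.min s0 (1 - s0).
      near: s; move/cvgrPdist_lt: (@cvg_id _ (nbhs s0)); apply; rewrite lt_min; lra.
    split=> //; move: ss0; rewrite lt_min !ltr_norml => ss0.
    have sI : 0 < s < 1 by lra.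
    rewrite (wptE k sI); apply: ang_circ_inj.
      apply: ang_mod_inj => /=.
      have := cocycle_mod cD x (I x (s - s0)); rewrite px DI /= => h.
      by apply: (int_eq h); ring.
    apply: (@circ_near _ k s0 s01); rewrite -px; near: s.
    apply: (proj_near pp); last exact: edist_gt0 (exist _ s0 s01).
    rewrite -[X in _ --> X](flow0 fl x) -I0.
    by apply: (flow_cvg fl); [exact: Icvg|exact: cvg_cst].
  move=> /nbhs_ballP[d /= d0 hd].
  apply: (@pos_at_reparam _ (fun s => q (phi s x)) _ (fun s => I x (s - s0)) s0 d) => //.
  + move=> t td; have [|_ <-] := hd t; first by rewrite /ball /= distrC.
    exact: up.
  + by move=> s t st; rewrite -(cocycle_lt cD x) !DI; lra.
  + by rewrite I0; case: pq => _ _ _ h; exact: h.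
Unshelve. all: by end_near. Qed.

Section Expansion.
Variables (x0 : X) (n : nat -> nat) (f : nat -> wpoint R -> wpoint R) (p : nat -> X -> wpoint R).
Hypothesis ep : expansion phi x0 n f p.

Lemma expansion_fibre_le i j x x' : (i <= j)%N -> p j x = p j x' -> p i x = p i x'.
Proof. by case: ep => _ _ _ fE _ ij jx; rewrite !(fE i j)// jx. Qed.

Lemma expansion_projection i : projection phi (n i) (p i).
Proof. by case: ep. Qed.

Lemma expansion_base i : p i x0 = None.
Proof. by case: ep. Qed.

(** Compactness of the square: a pair off the diagonal is separated, with all nearby pairs, by some
    [p i] and hence by every later one. *)
Lemma expansion_fibres_small (P : X -> X -> Prop) :
  (forall a : X, \forall z \near (a, a), P z.1 z.2) ->
  exists N, forall i, (N <= i)%N -> forall x x', p i x = p i x' -> P x x'.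
Proof.
move=> Pdiag.
have cXX : compact [set: X * X] by rewrite -setXTT; exact: compact_setX.
have [|N hN] := @compact_uniform_nat (X * X)%type cXX
    (fun i z => p i z.1 = p i z.2 -> P z.1 z.2); last first.
  by exists N => i Ni x x'; exact: (hN i Ni (x, x')).
move=> [x x']; have [<-|xx'] := pselect (x = x').
  by exists 0%N; apply: filterS (Pdiag x) => z Pz i _ _.
have [i pi] : exists i, p i x <> p i x'.
  apply: contrapT => h; apply: xx'; case: ep => _ _ _ _ [sep _ _]; apply: sep => i.
  by apply: contrapT => h'; apply: h; exists i.
exists i; have w3 : 0 < wdist (p i x) (p i x') / 3 by have := wdist_gt0 pi; lra.
near=> z => j ij /(expansion_fibre_le ij) pz; exfalso.
have h1 : wdist (p i x) (p i z.1) < wdist (p i x) (p i x') / 3.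
  by near: z; apply: (proj_near (expansion_projection i)) => //; exact: cvg_fst.
have h2 : wdist (p i x') (p i z.2) < wdist (p i x) (p i x') / 3.
  by near: z; apply: (proj_near (expansion_projection i)) => //; exact: cvg_snd.
have := wdist_triangle (p i z.1) (p i x) (p i x').
by rewrite {2}pz (wdistC (p i z.2)); lra.
Unshelve. all: by end_near. Qed.

(** Two points in one fibre of a late [p i] are close together and share their value of [p m], so
    local determination applies to them. *)
Lemma expansion_factor m k (q : X -> wpoint R) : projection phi k q -> q x0 = None ->
  locally_determined q (p m) ->
  exists N, forall i, (N <= i)%N -> exists u, positive_map (n i) k u /\ forall x, u (p i x) = q x.
Proof.
move=> pq q0 det.
have [N hN] := @expansion_fibres_small (fun x x' => p m x = p m x' -> q x = q x') det.
exists (maxn N m) => i; rewrite geq_max => /andP[Ni mi].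
apply: (projection_factor (expansion_projection i) pq (expansion_base i) q0) => x x' pix.
by apply: (hN i Ni x x' pix); exact: expansion_fibre_le pix.
Qed.

End Expansion.
End LocalDetermination.

(** * Time changes and displacements along orbits *)

Section TimeChange.
Variable R : realType.

(** The [tau] of [flow_equiv] may jump by periods of an orbit; here the parameter is normalised to
    be 0 and continuous at time 0. *)
Definition time_change (X Y : topologicalType) (phi : R -> X -> X) (psi : R -> Y -> Y)
    (h : X -> Y) : Prop :=
  forall x, exists v : R -> R, [/\ forall s t, s < t -> v s < v t,
    v t @[t --> (0 : R)] --> (0 : R), v 0 = 0 & forall t, h (phi t x) = psi (v t) (h x)].

Lemma projection_comp (X Y : topologicalType) (phi : R -> X -> X) (psi : R -> Y -> Y)
    (h : X -> Y) n q :
  is_flow phi -> homeo h -> time_change phi psi h ->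
  projection psi n q -> projection phi n (q \o h).
Proof.
move=> fl [ch [g [hg gh cg]]] tc pq; split.
- by move=> x; case: pq => inq _ _ _; exact: inq.
- move=> x e e0; case: pq => _ cq _ _; exact: (ch x _ (cq (h x) e e0)).
- move=> y yn; case: pq => _ _ /(_ y yn)[z <-] _; exists (g z).
  by rewrite /= gh.
- move=> x; have [v [vinc vc v0 vE]] := tc x.
  apply: (@pos_at_reparam _ (fun s => q (psi s (h x))) _ v 0 1) => //.
  + by move=> t _; rewrite /= vE.
  + by rewrite v0.
  + by rewrite v0; case: pq => _ _ _; exact.
Qed.

Lemma expansion_comp (X Y : topologicalType) (phi : R -> X -> X) (psi : R -> Y -> Y)
    (h : X -> Y) x0 n f q :
  is_flow phi -> homeo h -> time_change phi psi h ->
  expansion psi (h x0) n f q -> expansion phi x0 n f (fun i => q i \o h).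
Proof.
move=> fl hh tc [pf pq q0 qE [sep surj top]].
have [ch [g [hg gh cg]]] := hh.
split=> //.
- by move=> i; exact: (projection_comp fl hh tc).
- by move=> i j x ij; exact: qE.
- split.
  + by move=> x y /sep /(can_inj hg).
  + by move=> z zn zf; have [y hy] := surj z zn zf; exists (g y) => i; rewrite /= gh.
  + move=> x U oU Ux.
    have oV : open (g @^-1` U) by apply: open_comp => // y _; exact: cg.
    have [|F [e [e0 Fe]]] := top (h x) (g @^-1` U) oV; first by rewrite /= hg.
    by exists F, e; split=> // y hy; have := Fe (h y) hy; rewrite /= hg.
Qed.

Section Shift.
Variables (X : topologicalType) (phi : R -> X -> X) (r : X -> R).
Hypotheses (fl : is_flow phi) (cX : compact [set: X]) (cr : continuous r).
Hypothesis rinc : forall x s t, s < t -> s + r (phi s x) < t + r (phi t x).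

Definition flow_shift x := phi (r x) x.

Let rphi_cont x : continuous (fun s => s + r (phi s x)).
Proof.
move=> s; apply: cvgD; first exact: cvg_id.
by apply: continuous_comp; [exact: flow_continuous_time|exact: cr].
Qed.

(** The inverse follows the orbit to the time [s] with [s + r (phi s x) = 0]. It exists because [r]
    is bounded, is unique by [rinc], and depends continuously on [x] by [zero_continuous]. *)
Lemma flow_shift_homeo : homeo flow_shift.
Proof.
have cphi (f : X -> R) : continuous f -> continuous (fun x => phi (f x) x).
  by move=> cf x; apply: (flow_cvg fl); [exact: cf|exact: cvg_id].
split; first exact: cphi.
have /choice[io ioE] : forall x, exists s, s + r (phi s x) = 0.
  move=> x.
  have X0 : [set: X] !=set0 by exists x.
  have rs := @continuous_subspaceT _ _ [set: X] r cr.
  have [c _ hc] := compact_EVT_min X0 cX rs.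
  have [d _ hd] := compact_EVT_max X0 cX rs.
  have hr y : r c <= r y <= r d by rewrite hc ?hd ?inE.
  have [|s _ hs] := @ivt_zero _ _ (- r d) (- r c) (@rphi_cont x); last by exists s.
  have := hr (phi (- r c) x); have := hr (phi (- r d) x); lra.
have cio : continuous io.
  apply: (@zero_continuous _ _ (fun x s => s + r (phi s x))) => //= s x.
  apply: cvgD; first exact: cvg_cst.
  apply: continuous_comp; last exact: cr.
  by apply: (flow_cvg fl); [exact: cvg_cst|exact: cvg_id].
exists (fun x => phi (io x) x); split.
- move=> x; rewrite /flow_shift; have := ioE (phi (r x) x); set s := io _.
  rewrite -!(flowD fl) => hs.
  suff -> : s = - r x by rewrite subrr flow0.
  have h0 : (- r x) + r (phi (- r x) (phi (r x) x)) = 0.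
    by rewrite -(flowD fl) subrr flow0// addNr.
  have h1 : s + r (phi s (phi (r x) x)) = 0 by rewrite -(flowD fl).
  by case: (ltgtP s (- r x)) => // /(rinc (phi (r x) x)); rewrite h0 h1 ltxx.
- by move=> x; rewrite /flow_shift -(flowD fl) ioE flow0.
- exact: cphi.
Qed.

Lemma flow_shift_orbit x t : flow_shift (phi t x) = phi (t + r (phi t x) - r x) (flow_shift x).
Proof. by rewrite /flow_shift -!(flowD fl); congr phi; lra. Qed.

Lemma flow_shift_time_change : time_change phi phi flow_shift.
Proof.
move=> x; exists (fun t => t + r (phi t x) - r x); split.
- by move=> s t st; have := rinc x st; lra.
- have h : s + r (phi s x) @[s --> (0 : R)] --> r x.
    have e0 : (0 : R) + r (phi 0 x) = r x by rewrite (flow0 fl) add0r.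
    by rewrite -[X in _ --> X]e0; exact: (@rphi_cont x 0).
  by rewrite -[X in _ --> X](subrr (r x)); apply: cvgB h _; exact: cvg_cst.
- by rewrite (flow0 fl) add0r subrr.
- by move=> t; exact: flow_shift_orbit.
Qed.

Lemma flow_shift_flow_equiv : flow_equiv phi phi flow_shift.
Proof.
have hom := flow_shift_homeo; split=> // x; split.
  rewrite eqEsubset; split=> [_ [_ [t _ <-] <-]|_ [t _ <-]].
    by exists (t + r (phi t x) - r x) => //; rewrite flow_shift_orbit.
  case: hom => _ [g [_ gK _]]; set y := phi t _.
  exists (g y); last exact: gK.
  exists (r x + t - r (g y)) => //.
  have yE : phi (r (g y)) (g y) = y := gK y.
  rewrite !(flowD fl) -/(flow_shift x) -/y -[X in phi _ X = _]yE -(flowD fl) subrr.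
  exact: flow0.
exists (fun t => t + r (phi t x) - r x); split; last by move=> t; exact: flow_shift_orbit.
by move=> s t st; have := rinc x st; lra.
Qed.

End Shift.

Lemma flow_equiv_comp (X Y Z : topologicalType) (phi : R -> X -> X) (psi : R -> Y -> Y)
    (rho : R -> Z -> Z) (h : X -> Y) (k : Y -> Z) :
  flow_equiv phi psi h -> flow_equiv psi rho k -> flow_equiv phi rho (k \o h).
Proof.
move=> [[ch [h' [hK h'K ch']]] hE] [[ck [k' [kK k'K ck']]] kE]; split.
  split; first by move=> x; apply: continuous_comp; [exact: ch|exact: ck].
  exists (h' \o k'); split.
  - by move=> x /=; rewrite kK hK.
  - by move=> x /=; rewrite h'K k'K.
  - by move=> x; apply: continuous_comp; [exact: ck'|exact: ch'].
move=> x; have [hi [v [vinc vE]]] := hE x; have [ki [w [winc wE]]] := kE (h x).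
split; first by rewrite -image_comp hi ki.
exists (w \o v); split; first by move=> s t st; apply/winc/vinc.
by move=> t; rewrite /= vE wE.
Qed.

(** * Time changes obtained from flow equivalences *)

Lemma metrizable_hausdorff (Y : topologicalType) : metrizable R Y -> hausdorff_space Y.
Proof.
move=> [d [d0 dE dC dT dO]]; rewrite open_hausdorff => x y xy.
have dxy : 0 < d x y.
  by rewrite lt_neqAle d0 andbT eq_sym; apply: contra_neqN xy => /eqP /dE ->.
pose B z := [set w | d z w < d x y / 2].
have oB z : open (B z).
  apply/dO => w Bw; exists (d x y / 2 - d z w); first by rewrite subr_gt0.
  by move=> v wv; rewrite /B /=; have := dT z w v; lra.
exists (B x, B y); first by rewrite !inE /B /= ((dE x x).2 erefl) ((dE y y).2 erefl); lra.
split; [exact: oB|exact: oB|]; apply/eqP/seteqP; split=> // z [/= xz yz].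
by rewrite /B /= in xz yz; have := dT x z y; rewrite (dC z y); lra.
Qed.

(* A jump of [tau] at [0] is a period of [y], so it can be subtracted. *)
Lemma right_period (Y : topologicalType) (psi : R -> Y -> Y) (y : Y) (alpha : R -> Y)
    (tau : R -> R) :
  is_flow psi -> hausdorff_space Y -> (forall s t, s < t -> tau s < tau t) ->
  (forall t, alpha t = psi (tau t) y) -> alpha t @[t --> (0 : R)] --> y ->
  exists L, [/\ psi L y = y, forall t, 0 < t -> L < tau t &
    forall e, 0 < e -> exists2 d : R, 0 < d & forall t, 0 < t < d -> tau t < L + e].
Proof.
move=> fl haus tinc aE ay.
pose A := [set tau t | t in [set t | 0 < t]].
have hA : has_inf A.
  split; first by exists (tau 1), 1 => //=.
  by exists (tau 0) => _ [s /= sd <-]; apply/ltW/tinc.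
have lb t : 0 < t -> inf A < tau t.
  move=> t0; apply: (@le_lt_trans _ _ (tau (t / 2))); last by apply: tinc; lra.
  by apply: ge_inf; [case: hA|exists (t / 2) => //=; lra].
have adh e : 0 < e -> exists2 d : R, 0 < d & forall t, 0 < t < d -> tau t < inf A + e.
  move=> e0; have [_ [d /= d0 <-] hd] := inf_adherent e0 hA.
  by exists d => // t /andP[t0 td]; apply: lt_trans hd; exact: tinc.
(* From the right, [alpha] tends both to [y] and to [psi (inf A) y]. *)
exists (inf A); split=> //.
have c1 : alpha t @[t --> 0^'+] --> y by exact: cvg_at_right_filter.
have c2 : alpha t @[t --> 0^'+] --> psi (inf A) y.
  under eq_fun do rewrite aE.
  apply: (flow_cvg fl); last exact: cvg_cst.
  apply/cvgrPdist_lt => e e0; have [d d0 hd] := adh e e0.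
  near=> t.
  have t0 : 0 < t by near: t; exact: nbhs_right_gt.
  have td : t < d by near: t; exact: nbhs_right_lt.
  by have := lb t t0; have := hd t; rewrite t0 td ltr_norml => /(_ isT); lra.
exact: (cvg_unique haus c2 c1).
Unshelve. all: by end_near. Qed.

Lemma flow_equiv_time_change (X Y : topologicalType) (phi : R -> X -> X) (psi : R -> Y -> Y)
    (h : X -> Y) :
  is_flow phi -> is_flow psi -> hausdorff_space Y -> flow_equiv phi psi h ->
  time_change phi psi h.
Proof.
move=> fl fl' haus [[ch _] hE] x; have [_ [tau [tinc tE]]] := hE x.
have ca : h (phi t x) @[t --> (0 : R)] --> h x.
  have c0 : phi t x @[t --> (0 : R)] --> x.
    by rewrite -[X in _ --> X](flow0 fl x); exact: (flow_continuous_time fl).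
  exact: (cvg_comp _ _ c0 (ch x)).
have [L [Ly Llt Ladh]] := right_period fl' haus tinc tE ca.
have fl'' : is_flow (fun t => psi (- t)).
  case: (fl') => c0 p0 pD; split; last by move=> s t y; rewrite opprD pD.
    move=> [s y]; apply: (flow_cvg fl'); last exact: cvg_snd.
    by apply: cvgN; exact: cvg_fst.
  by move=> y; rewrite oppr0.
have [|||M [My Mlt Madh]] :=
    @right_period Y (fun t => psi (- t)) (h x) (fun t => h (phi (- t) x)) (fun t => - tau (- t))
    fl'' haus.
- by move=> s t st; rewrite ltrN2; apply: tinc; rewrite ltrN2.
- by move=> t; rewrite opprK.
- have cN : - t @[t --> (0 : R)] --> (0 : R) by rewrite -{2}oppr0; apply: cvgN; exact: cvg_id.
  exact: (cvg_comp _ _ cN ca).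
have psiN L' : psi L' (h x) = h x -> psi (- L') (h x) = h x.
  by move=> e; rewrite -[X in psi (- L') X]e -(flowD fl') subrr flow0.
(* [L] and [M] are the periods found for the forward and the reversed flow; removing them closes the
   jumps of [tau] on both sides of 0. *)
pose v t := if 0 < t then tau t - L else if t < 0 then tau t + M else 0.
have vp t : 0 < t -> v t = tau t - L by rewrite /v => ->.
have vn t : t < 0 -> v t = tau t + M by move=> t0; rewrite /v t0 ltNge (ltW t0).
have v0 : v 0 = 0 by rewrite /v ltxx.
have vp0 t : 0 < t -> 0 < v t by move=> t0; rewrite vp//; have := Llt t t0; lra.
have vn0 t : t < 0 -> v t < 0.
  by move=> t0; rewrite vn//; have := Mlt (- t); rewrite oppr_gt0 opprK => /(_ t0); lra.
exists v; split => //.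
- move=> s t st; have [s0|s0|s0] := ltgtP s 0; have [t0|t0|t0] := ltgtP t 0; try lra.
  + by rewrite !vn//; have := tinc _ _ st; lra.
  + by have := vp0 t t0; have := vn0 s s0; lra.
  + by rewrite t0 v0; exact: vn0.
  + by rewrite !vp//; have := tinc _ _ st; lra.
  + by rewrite s0 v0; exact: vp0.
- apply/cvgrPdist_lt => e e0.
  have [d d0 hd] := Ladh e e0; have [d' d'0 hd'] := Madh e e0.
  near=> t; rewrite sub0r normrN.
  have td : `|t| < Num.min d d'.
    by near: t; apply: (cvgr_norm_lt 0 cvg_id); rewrite normr0 lt_min d0.
  move: td; rewrite lt_min !ltr_norml => td.
  case: (ltgtP t 0) => t0.
  + have := vn0 t t0; rewrite vn// => h1.
    by have := hd' (- t); rewrite opprK => /(_ ltac:(lra)); lra.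
  + have := vp0 t t0; rewrite vp// => h1.
    by have := hd t ltac:(lra); lra.
  + by rewrite t0 v0; lra.
- move=> t; rewrite tE; case: (ltgtP t 0) => t0.
  + by rewrite vn// addrC (flowD fl') -{1}(psiN _ My) opprK.
  + by rewrite vp// addrC (flowD fl') psiN.
  + by rewrite t0 v0 -tE (flow0 fl) (flow0 fl').
Unshelve. all: by end_near. Qed.

End TimeChange.

(** * Straightening one projection with respect to another *)

Section Straightening.
Variables (R : realType) (X : topologicalType) (phi : R -> X -> X).
Hypotheses (fl : is_flow phi) (cX : compact [set: X]).
Variables (n : nat) (p : X -> wpoint R) (Dp Ip : X -> R -> R).
Hypotheses (pp : projection phi n p) (cDp : angle_cocycle phi p Dp).
Hypotheses (DIp : forall x u, Dp x (Ip x u) = u).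
Hypothesis Ip_cont : continuous (fun z : X * R => Ip z.1 z.2).
Variables (m : nat) (q : X -> wpoint R) (Dq Iq : X -> R -> R).
Hypotheses (pq : projection phi m q) (cDq : angle_cocycle phi q Dq).
Hypotheses (DIq : forall x u, Dq x (Iq x u) = u).
Hypothesis Iq_cont : continuous (fun z : X * R => Iq z.1 z.2).

Let c y := cen (ang (q y)).
(* The flow reparametrised so that the angle of [p] moves with unit speed; [E] is the
   angle cocycle of [q] over it. *)
Let ps u x := phi (Ip x u) x.
Let E x u := Dq x (Ip x u).

(** The bound 1/8 keeps [c] away from the jump of [cen]; the bound [2 * kappa] makes [N] positive,
    since the two offsets in [N] are each below [kappa]. *)
Variable kappa : R.
Hypothesis kappa8 : kappa <= 8^-1.
Hypothesis c_small : forall z, p z = None -> `|c z| < kappa.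
Hypothesis E_large : forall z, p z = None -> 2 * kappa <= E z 1.

Let Ip_uniq x s u : Dp x s = u -> Ip x u = s.
Proof. by move=> <-; apply: (cocycle_inj cDp (x := x)); rewrite DIp. Qed.

Let IpD x u v : Ip x (u + v) = Ip x u + Ip (ps u x) v.
Proof. by apply: Ip_uniq; rewrite (cocycleD cDp) !DIp. Qed.

Let Ip0 x : Ip x 0 = 0.
Proof. by apply: Ip_uniq; rewrite (cocycle0 fl cDp). Qed.

Let ps0 x : ps 0 x = x.
Proof. by rewrite /ps Ip0 (flow0 fl). Qed.

Let psD u v x : ps (u + v) x = ps v (ps u x).
Proof. by rewrite /ps IpD (flowD fl). Qed.

Let ps_cvg (T : Type) (F : set_system T) {FF : Filter F} (f : T -> R) (g : T -> X)
    (u : R) (x : X) :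
  f t @[t --> F] --> u -> g t @[t --> F] --> x -> ps (f t) (g t) @[t --> F] --> ps u x.
Proof.
move=> fu gx; apply: (flow_cvg fl) => //.
exact: (continuous2_cvg _ (h := Ip) (@Ip_cont (x, u)) gx fu).
Qed.

Let ps_mod x u : ang (p (ps u x)) - ang (p x) - u \is a Num.int.
Proof. by have := cocycle_mod cDp x (Ip x u); rewrite DIp. Qed.

Let ps_ang x u : 0 <= ang (p x) + u < 1 -> ang (p (ps u x)) = ang (p x) + u.
Proof.
move=> h; apply/eqP; rewrite -subr_eq0; apply/eqP/intr_small.
  by apply: (int_eq (ps_mod x u)); ring.
have := ang_ge0 (p (ps u x)); have := ang_lt1 (p (ps u x)).
by rewrite ltr_norml; lra.
Qed.

Let ED x u v : E x (u + v) = E x u + E (ps u x) v.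
Proof. by rewrite /E IpD (cocycleD cDq). Qed.

Let E0 x : E x 0 = 0.
Proof. by rewrite /E Ip0 (cocycle0 fl cDq). Qed.

Let E_cvg (T : Type) (F : set_system T) {FF : Filter F} (f : T -> R) (g : T -> X)
    (u : R) (x : X) :
  f t @[t --> F] --> u -> g t @[t --> F] --> x -> E (g t) (f t) @[t --> F] --> E x u.
Proof.
move=> fu gx; apply: (cocycle_cvg cDq) => //.
exact: (continuous2_cvg _ (h := Ip) (@Ip_cont (x, u)) gx fu).
Qed.

Let E_mod x u : ang (q (ps u x)) - ang (q x) - E x u \is a Num.int.
Proof. exact: (cocycle_mod cDq x (Ip x u)). Qed.

Let c_mod y : ang (q y) - c y \is a Num.int.
Proof. exact: cen_mod. Qed.

Let c_cvg (T : Type) (F : set_system T) {FF : Filter F} (g : T -> X) (y : X) :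
  p y = None -> g t @[t --> F] --> y -> c (g t) @[t --> F] --> c y.
Proof.
move=> py gy; apply: (@cvg_comp _ _ _ g c _ (nbhs y)) => //.
apply/cvgrPdist_lt => e e0; near=> z.
have h8 : `|cen (ang (q z) - ang (q y))| < 8^-1.
  by near: z; apply: (cen_ang_near pq); lra.
have he : `|cen (ang (q z) - ang (q y))| < e by near: z; exact: (cen_ang_near pq).
have cy := c_small py.
rewrite (_ : c z = c y + cen (ang (q z) - ang (q y))).
  by rewrite opprD addNKr normrN.
apply: cen_uniq.
  by apply: (int_eq (rpredD (c_mod y) (cen_mod (ang (q z) - ang (q y))))); ring.
by apply: le_lt_trans (ler_normD _ _) _; have := kappa8; lra.
Unshelve. all: by end_near. Qed.

Let th x := ang (p x).
(** The last visit of the orbit to the wedge point of [p], which is [x] itself when [x] is such a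
    visit. *)
Let zb x := ps (- th x) x.

Let zb_None x : p (zb x) = None.
Proof.
by apply: ang_eq0; rewrite /zb ps_ang /th subrr ?lexx// ltr01.
Qed.

Let ps1_None z v : p z = None -> v \is a Num.int -> p (ps v z) = None.
Proof.
move=> pz vi; apply/ang_eq0/intr_small.
  have := ps_mod z v; rewrite pz subr0 => h.
  by apply: (int_eq (rpredD h vi)); ring.
by rewrite ger0_norm ?ang_ge0// ang_lt1.
Qed.

(* The number of turns of [q] until the next visit to the wedge point of [p], once the
   two visits [z] and [ps 1 z] are moved to the wedge point of [q] nearby. *)
Let N z := E z 1 + c z - c (ps 1 z).

Let N_int z : N z \is a Num.int.
Proof.
have h1 := c_mod z; have h2 := c_mod (ps 1 z); have h3 := E_mod z 1.
by apply: (int_eq (rpredB (rpredB h2 h1) h3)); rewrite /N; ring.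
Qed.

Let N_ge1 z : p z = None -> 1 <= N z.
Proof.
move=> pz; have h1 := c_small pz.
have h2 : `|c (ps 1 z)| < kappa by apply/c_small/ps1_None => //; exact: rpred1.
have N0 : 0 < N z by have := E_large pz; move: h1 h2; rewrite /N !ltr_norml; lra.
by have := norm_intr_ge1 (N_int z); rewrite gtr0_norm// gt_eqF//; exact.
Qed.

Let N_cvg (T : Type) (F : set_system T) {FF : Filter F} (g : T -> X) (y : X) :
  p y = None -> g t @[t --> F] --> y -> N (g t) @[t --> F] --> N y.
Proof.
move=> py gy; apply: cvgB.
  apply: cvgD; last exact: c_cvg.
  by apply: E_cvg => //; exact: cvg_cst.
apply: c_cvg; first by apply: ps1_None => //; exact: rpred1.
by apply: ps_cvg => //; exact: cvg_cst.
Qed.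

(** A continuous integer-valued quantity is locally constant. *)
Let N_near (T : Type) (F : set_system T) {FF : Filter F} (g : T -> X) (y : X) :
  p y = None -> g t @[t --> F] --> y -> \forall t \near F, N (g t) = N y.
Proof.
move=> py gy; have cN : N (g t) @[t --> F] --> N y by exact: N_cvg.
move/cvgrPdist_lt: cN => cN.
apply: filterS (cN 1 ltr01) => t h; apply/esym/eqP; rewrite -subr_eq0; apply/eqP/intr_small => //.
by rewrite rpredB// N_int.
Qed.

(** The turning still missing at [ps v y]: the target [v * N y] minus the lifted angle [c y + E y v]
    of [q]. *)
Let S y v := v * N y - c y - E y v.

Let S_cvg (T : Type) (F : set_system T) {FF : Filter F} (f : T -> R) (g : T -> X)
    (v : R) (y : X) :
  p y = None -> f t @[t --> F] --> v -> g t @[t --> F] --> y -> S (g t) (f t) @[t --> F] --> S y v.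
Proof.
move=> py fv gy; apply: cvgB; last exact: E_cvg.
by apply: cvgB; [apply: cvgM => //; exact: N_cvg|exact: c_cvg].
Qed.

(* The lift of [th * N] through [ang \o q]: moving [x] by [rho x] in angle puts it where
   [q] has angle [th x * N (zb x)], which [p] determines locally. *)
Let rho x := S (zb x) (th x).

(** [zb] jumps where the orbit visits the wedge point. The nearest visit [y] does not, and [zb x] is
    either [y] or the visit before it. *)
Let near_zb x : let w := cen (th x) in let y := ps (- w) x in
  p y = None /\ ((th x = w /\ zb x = y) \/ (th x = 1 + w /\ zb x = ps (- 1) y)).
Proof.
move=> w y.
have pz := zb_None x; have th0 := ang_ge0 (p x); have th1 := ang_lt1 (p x).
rewrite -/(th x) in th0 th1.
have [t2|t2] := ltP (th x) 2^-1.
  have we : w = th x by apply: cen_uniq; rewrite ?subrr ?rpred0// ger0_norm.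
  by rewrite /y we; split=> //; left.
have we : w = th x - 1.
  apply/eqP; rewrite -subr_eq0; apply/eqP/intr_small.
    by apply: (int_eq (rpredB (rpred1 _) (cen_mod (th x)))); rewrite -/w; ring.
  have := cen_ge (th x); have := cen_lt (th x); rewrite -/w => w1 w2.
  by rewrite ltr_norml; lra.
have zy : zb x = ps (- 1) y by rewrite /zb /y -psD we; congr ps; ring.
have yz : y = ps 1 (zb x) by rewrite zy -psD addNr ps0.
split; first by rewrite yz; apply: ps1_None => //; exact: rpred1.
by right; split=> //; rewrite we; ring.
Qed.

Let th_cvg a : p a <> None -> th x @[x --> a] --> th a.
Proof.
move=> pa; have th0 : 0 < th a.
  by rewrite lt_neqAle ang_ge0 andbT eq_sym; apply/eqP => /ang_eq0.
have th1 := ang_lt1 (p a); rewrite -/(th a) in th1.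
apply/cvgrPdist_lt => e e0; near=> x.
have h1 : `|cen (th x - th a)| < e by near: x; exact: (cen_ang_near pp).
have h2 : `|cen (th x - th a)| < Num.min (th a) (1 - th a).
  by near: x; apply: (cen_ang_near pp); rewrite lt_min th0; lra.
suff e1 : th x - th a - cen (th x - th a) = 0.
  by rewrite distrC (_ : th x - th a = cen (th x - th a))//; lra.
apply: intr_small; first exact: cen_mod.
have := ang_ge0 (p x); have := ang_lt1 (p x); rewrite -/(th x).
by move: h2; rewrite lt_min !ltr_norml; lra.
Unshelve. all: by end_near. Qed.

Let zb_cvg a : p a <> None -> zb x @[x --> a] --> zb a.
Proof. by move=> pa; apply: ps_cvg; [apply: cvgN; exact: th_cvg|exact: cvg_id]. Qed.

Let w_cvg a : p a = None -> cen (th x) @[x --> a] --> (0 : R).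
Proof.
move=> pa; apply/cvgrPdist_lt => e e0; near=> x; rewrite sub0r normrN.
by near: x; apply: filterS (cen_ang_near pp a e0) => x; rewrite pa subr0.
Unshelve. all: by end_near. Qed.

Let y_cvg a : p a = None -> ps (- cen (th x)) x @[x --> a] --> a.
Proof.
move=> pa; rewrite -[X in _ --> X]ps0 -[X in ps X]oppr0.
by apply: ps_cvg; [apply: cvgN; exact: w_cvg|exact: cvg_id].
Qed.

Let rho_cont : continuous rho.
Proof.
move=> a; have [pa|pa] := pselect (p a = None); last first.
  by apply: S_cvg; [exact: zb_None|exact: th_cvg|exact: zb_cvg].
have rhoa : rho a = - c a.
  by rewrite /rho /zb /th pa oppr0 ps0 /S E0 mul0r sub0r subr0.
have Sa : S a 0 = - c a by rewrite /S E0 mul0r sub0r subr0.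
have pa' : p (ps (- 1) a) = None by apply: ps1_None => //; exact: rpredN1.
(* [N] is chosen for this: after a full interval between visits the missing turning is again minus
   the offset [c a], so the two branches of [rho] agree at [a]. *)
have Sa' : S (ps (- 1) a) (1 + 0) = - c a.
  by rewrite /S addr0 mul1r /N -psD addNr ps0; ring.
have c1 : S (ps (- cen (th x)) x) (cen (th x)) @[x --> a] --> - c a.
  by rewrite -Sa; apply: S_cvg => //; [exact: w_cvg|exact: y_cvg].
have c2 : S (ps (- 1) (ps (- cen (th x)) x)) (1 + cen (th x)) @[x --> a] --> - c a.
  rewrite -Sa'; apply: S_cvg => //.
    by apply: cvgD; [exact: cvg_cst|exact: w_cvg].
  by apply: ps_cvg; [exact: cvg_cst|exact: y_cvg].
rewrite /continuous_at rhoa; apply/cvgrPdist_lt => e e0; near=> x.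
have h1 : `|- c a - S (ps (- cen (th x)) x) (cen (th x))| < e.
  by near: x; move/cvgrPdist_lt: c1; exact.
have h2 : `|- c a - S (ps (- 1) (ps (- cen (th x)) x)) (1 + cen (th x))| < e.
  by near: x; move/cvgrPdist_lt: c2; exact.
have [_ [[t1 z1]|[t1 z1]]] := near_zb x.
  rewrite (_ : rho x = S (ps (- cen (th x)) x) (cen (th x)))//.
  by rewrite /rho z1 -t1.
rewrite (_ : rho x = S (ps (- 1) (ps (- cen (th x)) x)) (1 + cen (th x)))//.
by rewrite /rho z1 -t1.
Unshelve. all: by end_near. Qed.

Let rho_flow x v : 0 <= v < 1 - th x -> E x v + rho (ps v x) = rho x + v * N (zb x).
Proof.
move=> hv; have th0 := ang_ge0 (p x); rewrite -/(th x) in th0.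
have thv : th (ps v x) = th x + v by rewrite /th ps_ang -/(th x)//; lra.
have zv : zb (ps v x) = zb x by rewrite /zb thv -psD; congr ps; ring.
rewrite /rho zv thv /S ED.
have -> : ps (th x) (zb x) = x by rewrite /zb -psD addNr ps0.
ring.
Qed.

(** This is the lifted angle of the moved point, up to a constant. By [rho_flow] it is affine with
    slope [N], at least 1, from any time until the next visit. *)
Let lift_incr x u u' : u < u' -> E x u + rho (ps u x) < E x u' + rho (ps u' x).
Proof.
have cps : continuous (ps ^~ x) by move=> v; apply: ps_cvg; [exact: cvg_id|exact: cvg_cst].
apply: (@right_local_incr _ (fun u => E x u + rho (ps u x))).
  move=> v; apply: cvgD; first by apply: E_cvg; [exact: cvg_id|exact: cvg_cst].
  by apply: (continuous_comp (cps v)); exact: rho_cont.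
move=> v; exists (1 - th (ps v x)); first by rewrite subr_gt0 ang_lt1.
move=> w /andP[w0 w1]; rewrite ED -addrA ltrD2l psD rho_flow ?(ltW w0)// ltrDl.
by rewrite mulr_gt0// (lt_le_trans ltr01)// N_ge1// zb_None.
Qed.

(** Converts the missing turning of [q] into flow time. *)
Let r x := Iq x (rho x).

(** After the shift [q] has angle [th x * N (zb x)] modulo 1. Both factors are locally determined by
    [p], and [near_same_angle] passes from angles to points. *)
Lemma straighten x0 : p x0 = None -> q x0 = None ->
  exists r : X -> R, [/\ continuous r, forall x s t, s < t -> s + r (phi s x) < t + r (phi t x),
    r x0 = 0 & locally_determined (q \o flow_shift phi r) p].
Proof.
move=> px0 qx0.
have Iq_uniq x s u : Dq x s = u -> Iq x u = s.
  by move=> <-; apply: (cocycle_inj cDq (x := x)); rewrite DIq.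
have cr : continuous r.
  move=> x; apply: (continuous2_cvg _ (h := Iq) (@Iq_cont (x, rho x)) _ (@rho_cont x)).
  exact: cvg_id.
have rinc x s t : s < t -> s + r (phi s x) < t + r (phi t x).
  have key s' : Dq x (s' + r (phi s' x)) = E x (Dp x s') + rho (ps (Dp x s') x).
    by rewrite (cocycleD cDq) DIq /E /ps (@Ip_uniq x s' _ erefl).
  by move=> st; rewrite -(cocycle_lt cDq x) !key lift_incr// (cocycle_lt cDp).
exists r; split => //.
  apply: Iq_uniq; rewrite (cocycle0 fl cDq) /rho /zb /th px0 oppr0 ps0 /S E0 mul0r.
  rewrite /c qx0 subr0 sub0r; apply/eqP; rewrite eq_sym oppr_eq0; apply/eqP.
  by apply: cen_uniq; rewrite ?subrr ?rpred0// normr0 invr_gt0.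
have angQ x : ang (q (flow_shift phi r x)) - th x * N (zb x) \is a Num.int.
  have h1 := cocycle_mod cDq x (r x); rewrite DIq in h1.
  have h2 := E_mod (zb x) (th x); rewrite -psD addNr ps0 in h2.
  have h3 := c_mod (zb x).
  by apply: (int_eq (rpredD h1 (rpredD h2 h3))); rewrite /rho /S /flow_shift; ring.
have pQ : projection phi m (q \o flow_shift phi r).
  apply: (projection_comp fl _ _ pq); first exact: flow_shift_homeo.
  exact: flow_shift_time_change.
(* Near a visit there are two possible values, those of [N] at [a] and at the visit before; equal
   [th] puts both points on the same branch of [near_zb]. *)
have Ndet (a : X) : \forall z \near (a, a), p z.1 = p z.2 -> N (zb z.1) = N (zb z.2).
  have [pa|pa] := pselect (p a = None).
    have pa' : p (ps (- 1) a) = None by apply: ps1_None => //; exact: rpredN1.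
    have n1 : \forall x \near a, N (ps (- cen (th x)) x) = N a by exact: N_near (y_cvg pa).
    have n2 : \forall x \near a, N (ps (- 1) (ps (- cen (th x)) x)) = N (ps (- 1) a).
      by apply: N_near => //; apply: ps_cvg; [exact: cvg_cst|exact: y_cvg].
    have nn : \forall x \near a, N (ps (- cen (th x)) x) = N a /\
        N (ps (- 1) (ps (- cen (th x)) x)) = N (ps (- 1) a).
      exact: filterI n1 n2.
    near=> z => pz.
    have [a1 a2] : N (ps (- cen (th z.1)) z.1) = N a /\
        N (ps (- 1) (ps (- cen (th z.1)) z.1)) = N (ps (- 1) a).
      by near: z; exact: (@cvg_fst _ _ (nbhs a) (nbhs a) _ _ nn).
    have [b1 b2] : N (ps (- cen (th z.2)) z.2) = N a /\
        N (ps (- 1) (ps (- cen (th z.2)) z.2)) = N (ps (- 1) a).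
      by near: z; exact: (@cvg_snd _ _ (nbhs a) (nbhs a) _ _ nn).
    have te : th z.1 = th z.2 by rewrite /th pz.
    have [_ [[t1 z1]|[t1 z1]]] := near_zb z.1; have [_ [[t2 z2]|[t2 z2]]] := near_zb z.2.
    - by rewrite z1 z2 a1 b1.
    - by move: t2; rewrite -te -t1; lra.
    - by move: t1; rewrite te -t2; lra.
    - by rewrite z1 z2 a2 b2.
  have n1 : \forall x \near a, N (zb x) = N (zb a).
    by apply: N_near; [exact: zb_None|exact: zb_cvg].
  near=> z => _; transitivity (N (zb a)).
    by near: z; exact: (@cvg_fst _ _ (nbhs a) (nbhs a) _ _ n1).
  by apply/esym; near: z; exact: (@cvg_snd _ _ (nbhs a) (nbhs a) _ _ n1).
move=> a; near=> z => pz.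
have h1 : p z.1 = p z.2 -> N (zb z.1) = N (zb z.2) by near: z; exact: Ndet.
have h2 : ang ((q \o flow_shift phi r) z.1) = ang ((q \o flow_shift phi r) z.2) ->
  (q \o flow_shift phi r) z.1 = (q \o flow_shift phi r) z.2.
  by near: z; exact: (near_same_angle fl cX pQ).
apply: h2; apply: ang_mod_inj.
have := rpredB (angQ z.1) (angQ z.2); rewrite (h1 pz) {1}/th pz -/(th z.2) => h.
by apply: (int_eq h); rewrite /=; ring.
Unshelve. all: by end_near. Qed.

End Straightening.

(** * The ladder of positive maps *)

Section Assembly.
Variables (R : realType) (X : topologicalType) (phi : R -> X -> X) (x0 : X).
Hypotheses (fl : is_flow phi) (cX : compact [set: X]).

Lemma expansion_straighten n f p k q :
  expansion phi x0 n f p -> projection phi k q -> q x0 = None ->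
  exists m (r : X -> R), [/\ continuous r,
    forall x s t, s < t -> s + r (phi s x) < t + r (phi t x),
    r x0 = 0 & locally_determined (q \o flow_shift phi r) (p m)].
Proof.
move=> ep pq qx0; have p0 := expansion_projection ep.
have [Dq cDq] := angle_cocycle_exists fl cX pq.
have [Iq [DIq Iqc]] := cocycle_inverse cDq.
have [D0 cD0] := angle_cocycle_exists fl cX (p0 0%N).
have [I0 [DI0 I0c]] := cocycle_inverse cD0.
(* The turning of [q] during one turn of [p 0]. Its minimum does not involve [m], so [kappa] can be
   fixed before [m] is chosen. *)
pose b z := Dq z (I0 z 1).
have cb : {within [set: X], continuous b}.
  apply: continuous_subspaceT => z; apply: (cocycle_cvg cDq); first exact: cvg_id.
  apply: (continuous2_cvg _ (h := I0) (I0c (z, 1))); [exact: cvg_id|exact: cvg_cst].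
have [z0 _ hz0] := compact_EVT_min (ex_intro _ x0 I) cX cb.
have b0 : 0 < b z0 by rewrite /b (cocycle_gt0 fl cDq) -(cocycle_gt0 fl cD0 z0) DI0.
have hb z : b z0 <= b z by apply: hz0; rewrite inE.
pose kappa := Num.min 8^-1 (b z0 / 2).
have k8 : kappa <= 8^-1 by rewrite ge_min lexx.
have kb : kappa <= b z0 / 2 by rewrite ge_min lexx orbT.
have k0 : 0 < kappa by rewrite lt_min; apply/andP; split; lra.
have [a|m hm] := @expansion_fibres_small _ _ phi cX x0 n f p ep
    (fun x x' => wdist (q x) (q x') < kappa).
  have k2 : 0 < kappa / 2 by lra.
  near=> z.
  have h1 : wdist (q a) (q z.1) < kappa / 2.
    by near: z; apply: (proj_near pq) => //; exact: cvg_fst.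
  have h2 : wdist (q a) (q z.2) < kappa / 2.
    by near: z; apply: (proj_near pq) => //; exact: cvg_snd.
  have := wdist_triangle (q a) (q z.1) (q z.2); rewrite (wdistC (q z.1) (q a)); lra.
have [Dp cDp] := angle_cocycle_exists fl cX (p0 m).
have [Ip [DIp Ipc]] := cocycle_inverse cDp.
have px0 := expansion_base ep.
exists m; apply: (straighten fl cX (p0 m) cDp DIp Ipc pq cDq DIq Iqc k8) => //.
  move=> z pz; have := hm m (leqnn m) z x0; rewrite pz px0 qx0 => /(_ erefl).
  by apply: le_lt_trans; have := cen_ang_le (q z) None; rewrite subr0.
move=> z pz.
have zI : 0 < Ip z 1 by rewrite -(cocycle_gt0 fl cDp z) DIp.
have pz' : p m (phi (Ip z 1) z) = None.
  apply/ang_eq0/intr_small.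
    have := cocycle_mod cDp z (Ip z 1); rewrite DIp pz subr0 => h.
    by apply: (int_eq (rpredD h (rpred1 _))); ring.
  by rewrite ger0_norm ?ang_ge0// ang_lt1.
have base y : p m y = None -> p 0%N y = None.
  by move=> py; rewrite -(px0 0%N); apply: (expansion_fibre_le ep (leq0n m)); rewrite px0.
(* Two successive visits for [p m] are also visits for [p 0], so [p 0] makes at least one full turn
   between them. *)
have := cocycle_mod cD0 z (Ip z 1); rewrite (base _ pz) (base _ pz') subrr sub0r rpredN => Di.
have D0p : 0 < D0 z (Ip z 1) by rewrite (cocycle_gt0 fl cD0).
have D01 : 1 <= D0 z (Ip z 1).
  by have := norm_intr_ge1 Di; rewrite gtr0_norm// gt_eqF//; exact.
have II : I0 z 1 <= Ip z 1 by rewrite leNgt -(cocycle_lt cD0 z) DI0 -leNgt.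
have DD : b z <= Dq z (Ip z 1) by rewrite leNgt (cocycle_lt cDq) -leNgt.
by have := hb z; lra.
Unshelve. all: by end_near. Qed.

(** The step from one exact relation to the next; its roles are symmetric, so it climbs both sides
    of the ladder alternately. *)
Lemma expansion_step n f p n' g q m l d (N : nat) :
  expansion phi x0 n f p -> expansion phi x0 n' g q -> (forall x, d (p m x) = q l x) ->
  exists i u, [/\ (N < i)%N, positive_map (n' i) (n m) u & forall x, u (q i x) = p m x].
Proof.
move=> ep eq dpq.
have det := left_factor_determined fl cX (expansion_projection ep m)
  (expansion_projection eq l) dpq.
have [M hM] := expansion_factor fl cX eq (expansion_projection ep m) (expansion_base ep m) det.
have [u [pu ue]] := hM (maxn M N.+1) (leq_maxl _ _).
by exists (maxn M N.+1), u; split => //; rewrite leq_max leqnn orbT.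
Qed.

(** Dependent choice on triples of two levels and an exact map between them. The triangle identities
    hold after composition with projections, which are surjective. *)
Lemma expansions_interleave nX f p nY g q m0 l0 d0 :
  expansion phi x0 nX f p -> expansion phi x0 nY g q ->
  positive_map (nX m0) (nY l0) d0 -> (forall x, d0 (p m0 x) = q l0 x) ->
  exists (m l : nat -> nat) (dk uk : nat -> wpoint R -> wpoint R),
   [/\ (forall k, (m k < m k.+1)%N) /\ (forall k, (l k < l k.+1)%N),
       (forall k, positive_map (nX (m k)) (nY (l k)) (dk k)) /\
         (forall k, positive_map (nY (l k.+1)) (nX (m k)) (uk k)),
       forall k z, inw (nX (m k.+1)) z -> uk k (dk k.+1 z) = fcomp f (m k) (m k.+1) z,
       forall k z, inw (nY (l k.+1)) z -> dk k (uk k z) = fcomp g (l k) (l k.+1) z &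
       forall k x, q (l k) x = dk k (p (m k) x)].
Proof.
move=> ep eq pd0 d0E.
pose good (s : nat * nat * (wpoint R -> wpoint R)) :=
  positive_map (nX s.1.1) (nY s.1.2) s.2 /\ forall x, s.2 (p s.1.1 x) = q s.1.2 x.
pose next (s s' : {s | good s}) := [/\ ((sval s).1.1 < (sval s').1.1)%N,
  ((sval s).1.2 < (sval s').1.2)%N & exists u,
  positive_map (nY (sval s').1.2) (nX (sval s).1.1) u /\
  forall x, u (q (sval s').1.2 x) = p (sval s).1.1 x].
have nextP s : {s' | next s s'}.
  apply: cid; case: s => [[[m l] d] /= [pd dE]] /=.
  have [l' [u [ll' pu uE]]] := expansion_step l ep eq dE.
  have [m' [d' [mm' pd' d'E]]] := expansion_step m eq ep uE.
  have gd : good (m', l', d') by split.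
  by exists (exist _ (m', l', d') gd); split=> //=; exists u.
have gd0 : good (m0, l0, d0) by split.
have [s [_ snext]] := dependent_choice nextP (exist _ (m0, l0, d0) gd0).
have /choice[u uE] : forall k, exists u,
    positive_map (nY (sval (s k.+1)).1.2) (nX (sval (s k)).1.1) u /\
    forall x, u (q (sval (s k.+1)).1.2 x) = p (sval (s k)).1.1 x.
  by move=> k; case: (snext k).
have psurj n k h r z : expansion phi x0 n h r -> inw (n k) z -> exists x, r k x = z.
  by move=> er; case: (expansion_projection er k) => _ _ + _; exact.
have dE k x : (sval (s k)).2 (p (sval (s k)).1.1 x) = q (sval (s k)).1.2 x.
  by case: (svalP (s k)).
exists (fun k => (sval (s k)).1.1), (fun k => (sval (s k)).1.2), (fun k => (sval (s k)).2), u.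
split.
- by split=> k; case: (snext k).
- by split=> k; [case: (svalP (s k))|case: (uE k)].
- move=> k z /(psurj _ _ _ _ _ ep)[x <-].
  rewrite dE (proj2 (uE k)); case: (snext k) => /ltnW mk _ _.
  by case: ep => _ _ _ + _; exact.
- move=> k z /(psurj _ _ _ _ _ eq)[x <-].
  rewrite (proj2 (uE k)) dE; case: (snext k) => _ /ltnW lk _.
  by case: eq => _ _ _ + _; exact.
- by [].
Qed.

End Assembly.

(** * The isotopy and the combinatorial isomorphism *)

Theorem theorem5p2 (R : realType) (X Y : topologicalType)
  (phi : R -> X -> X) (psi : R -> Y -> Y) (x0 : X) (y0 : Y) (h : X -> Y)
  (nX : nat -> nat) (f : nat -> wpoint R -> wpoint R) (p : nat -> X -> wpoint R)
  (nY : nat -> nat) (g : nat -> wpoint R -> wpoint R) (q : nat -> Y -> wpoint R) :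
  flow_space phi -> flow_space psi ->
  flow_equiv phi psi h -> h x0 = y0 ->
  expansion phi x0 nX f p -> expansion psi y0 nY g q ->
  exists d : X -> Y, isotopic R h d /\ comb_iso phi psi x0 y0 nX f p nY g q d.
Proof.
move=> [fl cX _ _ _] [fl' _ mY _ _] fh hx0 ep eq; rewrite -{y0}hx0 in eq *.
have haus := metrizable_hausdorff mY.
have [hh _] := fh.
have eqh := expansion_comp fl hh (flow_equiv_time_change fl fl' haus fh) eq.
have [m [r [cr rinc rx0 det]]] :=
  expansion_straighten fl cX ep (expansion_projection eqh 0%N) (expansion_base eqh 0%N).
have sx0 : flow_shift phi r x0 = x0 by rewrite /flow_shift rx0 (flow0 fl).
have eqd : expansion phi x0 nY g (fun i => (q i \o h) \o flow_shift phi r).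
  apply: (expansion_comp fl (flow_shift_homeo fl cX cr rinc) (flow_shift_time_change fl cr rinc)).
  by rewrite sx0.
(* This is the first exact relation, between [p M] and the straightened [q 0]. *)
have [M hM] := expansion_factor fl cX ep (expansion_projection eqd 0%N)
  (expansion_base eqd 0%N) det.
have [d0 [pd0 d0E]] := hM M (leqnn M).
have [mm [ll [dk [uk hk]]]] := expansions_interleave fl cX ep eqd pd0 d0E.
exists (h \o flow_shift phi r); split; last first.
  split; last by exists mm, ll, dk, uk.
    exact: flow_equiv_comp (flow_shift_flow_equiv fl cX cr rinc) fh.
  by rewrite /= sx0.
have [ch [h' [hK h'K ch']]] := hh.
exists (fun t x => h (phi (t * r x) x)); split.
- apply: continuous_subspaceT => -[t x].
  apply: (@cvg_comp _ _ _ (fun z : R * X => phi (z.1 * r z.2) z.2) h _ (nbhs (phi (t * r x) x)));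
    last exact: ch.
  apply: (flow_cvg fl); last exact: cvg_snd.
  apply: cvgM; first exact: cvg_fst.
  have c2 : z.2 @[z --> (t, x)] --> x by exact: cvg_snd.
  exact: (cvg_comp _ _ c2 (cr x)).
- move=> t /andP[t0 t1].
  (* For [t] in [0,1] the reparametrisation by [t * r] is a convex combination of the identity and
     the increasing one of [rinc]. *)
  have trinc x s s' : s < s' -> s + t * r (phi s x) < s' + t * r (phi s' x).
    move=> ss'; have rs := rinc x _ _ ss'.
    have [t1'|t1'] := ltP t 1; last first.
      have -> : t = 1 by apply: le_anti; rewrite t1 t1'.
      by rewrite !mul1r.
    have h1 : 0 <= t * (s' + r (phi s' x) - (s + r (phi s x))).
      by rewrite mulr_ge0// subr_ge0 ltW.
    have h2 : 0 < (1 - t) * (s' - s) by rewrite mulr_gt0// subr_gt0.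
    rewrite -subr_gt0; apply: lt_le_trans (_ : (1 - t) * (s' - s) +
      t * (s' + r (phi s' x) - (s + r (phi s x))) <= _); first exact: ltr_wpDr.
    by rewrite le_eqVlt; apply/orP; left; apply/eqP; ring.
  have ctr : continuous (fun x => t * r x).
    by move=> x; apply: cvgM; [exact: cvg_cst|exact: cr].
  have [ck [k' [kK k'K ck']]] := flow_shift_homeo fl cX ctr trinc.
  split; first by move=> x; apply: (continuous_comp (ck x)); exact: ch.
  exists (k' \o h'); split.
  + by move=> x /=; rewrite hK; exact: kK.
  + by move=> y /=; have := k'K (h' y); rewrite /flow_shift => ->; exact: h'K.
  + by move=> x; apply: continuous_comp; [exact: ch'|exact: ck'].
- by apply/funext => x; rewrite mul0r (flow0 fl).
- by apply/funext => x; rewrite mul1r.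
Qed.
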